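(* Let $n\ge2$, let $W$ be the Coxeter group of type $\tilde A_{n-1}$ with Coxeter generators $s_1,\dots,s_n$, and let $c=s_1s_2\cdots s_n$. Identify the Artin-Tits group $B(\tilde A_{n-1})$ with the group of fractions of $M(P_c)$, so that $M(P_c)\subset B(\tilde A_{n-1})$. Then: (i) Every element of $B(\tilde A_{n-1})$ can be written in a unique way as $a^{-1}b$ where $a$ and $b$ are elements of $M(P_c)$ that are coprime (no common left divisor other than $1$). (ii) Every element of $M(P_c)$ can be written in a unique way as $a_1a_2\cdots a_k$ where, for $i=1,\dots,k$, the element $a_i\in\underline P_c$ is the greatest left divisor lying in $\underline P_c$ of the product $a_ia_{i+1}\cdots a_k$, and $a_k\ne1$ (with $k=0$ for the element $1$).
   Context: The generators $s_1,\dots,s_n$ of $W$ are numbered cyclically so that $s_i$ and $s_{i+1}$ are joined in the Coxeter diagram (indices mod $n$). Let $R$ be the set of reflections (conjugates of the $s_i$) and $l_R(w)$ the least number of factors in an expression of $w\in W$ as a product of reflections. $v$ divides $w$ in $W$ if $w=vv'$ with $l_R(w)=l_R(v)+l_R(v')$. $P_c$ is the set of divisors of $c$. $M(P_c)$ is the monoid generated by a set $\underline P_c=\{\underline w\mid w\in P_c\}$ in bijection with $P_c$, with relations $\underline w.\underline{w'}=\underline{ww'}$ whenever $w,w',ww'\in P_c$ and $l_R(ww')=l_R(w)+l_R(w')$. In a monoid $M$, $a$ left-divides $m$ if $m\in aM$. $B(\tilde A_{n-1})$ is the group generated by $\mathbf s_1,\dots,\mathbf s_n$ with relations, for $n\ge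 3$, $\mathbf s_i\mathbf s_{i+1}\mathbf s_i=\mathbf s_{i+1}\mathbf s_i\mathbf s_{i+1}$ for $i=1,\dots,n$ (with $\mathbf s_{n+1}=\mathbf s_1$) and $\mathbf s_i\mathbf s_j=\mathbf s_j\mathbf s_i$ if $i\ne j$ and $i\not\equiv j\pm1\pmod n$; for $n=2$ it is free on $\mathbf s_1,\mathbf s_2$. It is isomorphic to the group of fractions of $M(P_c)$ via $\mathbf s_i\mapsto\underline{s_i}$. *)

(* Defs.v *)
From HB Require Import structures.
From mathcomp Require Import all_boot boolp.

Set Implicit Arguments.
Unset Strict Implicit.
Unset Printing Implicit Defensive.

Local Open Scope group_scope.
Local Open Scope quotient_scope.

Section PresentedMonoid.
Context (X : choiceType) (rel : seq X -> seq X -> Prop).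

Inductive word_congr : seq X -> seq X -> Prop :=
| word_congr_rel p q u v : rel u v -> word_congr (p ++ u ++ q) (p ++ v ++ q)
| word_congr_refl u : word_congr u u
| word_congr_sym u v : word_congr u v -> word_congr v u
| word_congr_trans u v w : word_congr u v -> word_congr v w -> word_congr u w.

Definition word_congrb (u v : seq X) : bool := `[< word_congr u v >].

Lemma word_congrb_refl : reflexive word_congrb.
Proof. by move=> u; apply/asboolP/word_congr_refl. Qed.

Lemma word_congrb_sym : symmetric word_congrb.
Proof. by move=> u v; apply/asboolP/asboolP; apply: word_congr_sym. Qed.

Lemma word_congrb_trans : transitive word_congrb.
Proof.
move=> v u w /asboolP uv /asboolP vw.
by apply/asboolP; apply: word_congr_trans uv vw.
Qed.

Canonical word_congr_equiv :=
  EquivRel word_congrb word_congrb_refl word_congrb_sym word_congrb_trans.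

Definition pres_monoid := {eq_quot word_congr_equiv}.

HB.instance Definition _ := EqQuotient.on pres_monoid.
HB.instance Definition _ := Choice.on pres_monoid.

Definition pm_class (u : seq X) : pres_monoid := \pi_pres_monoid u.

Lemma pm_classP u v : pm_class u = pm_class v <-> word_congr u v.
Proof.
rewrite /pm_class; split=> [/eqP|uv]; first by rewrite piE => /asboolP.
by apply/eqP; rewrite piE; apply/asboolP.
Qed.

Lemma pm_classW (P : pres_monoid -> Prop) :
  (forall u, P (pm_class u)) -> forall x, P x.
Proof. by move=> Pc x; rewrite -[x]reprK; apply: Pc. Qed.

Lemma word_congr_cat u u' v v' :
  word_congr u u' -> word_congr v v' -> word_congr (u ++ v) (u' ++ v').
Proof.
move=> uu' vv'; apply: (@word_congr_trans _ (u' ++ v)).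
  elim: uu' => {u u'} [p q u u' r|u|u u' _ IH|u1 u2 u3 _ IH1 _ IH2].
  - by rewrite -!catA; apply: word_congr_rel.
  - exact: word_congr_refl.
  - exact: word_congr_sym.
  - exact: word_congr_trans IH1 IH2.
elim: vv' => {v v'} [p q v v' r|v|v v' _ IH|v1 v2 v3 _ IH1 _ IH2].
- rewrite [u' ++ _ ++ _]catA [u' ++ p ++ v' ++ q]catA; exact: word_congr_rel.
- exact: word_congr_refl.
- exact: word_congr_sym.
- exact: word_congr_trans IH1 IH2.
Qed.

Definition pm_mul (x y : pres_monoid) : pres_monoid :=
  pm_class (repr x ++ repr y).

Lemma pm_mul_class u v : pm_mul (pm_class u) (pm_class v) = pm_class (u ++ v).
Proof.
by apply/pm_classP/word_congr_cat; apply/pm_classP; rewrite /pm_class reprK.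
Qed.

Lemma pm_mulA : associative pm_mul.
Proof.
elim/pm_classW=> u; elim/pm_classW=> v; elim/pm_classW=> w.
by rewrite !pm_mul_class catA.
Qed.

Lemma pm_mul1 : left_id (pm_class [::]) pm_mul.
Proof. by elim/pm_classW=> u; rewrite pm_mul_class. Qed.

Lemma pm_mulx1 : right_id (pm_class [::]) pm_mul.
Proof. by elim/pm_classW=> u; rewrite pm_mul_class cats0. Qed.

HB.instance Definition _ :=
  isMonoid.Build pres_monoid pm_mulA pm_mul1 pm_mulx1.

Lemma pm_classM u v : pm_class (u ++ v) = pm_class u * pm_class v.
Proof. by rewrite -pm_mul_class. Qed.

Lemma pm_class1 : pm_class [::] = 1.
Proof. by []. Qed.

End PresentedMonoid.

Section PresentedGroup.
Context (X : choiceType) (rel : seq X -> seq X -> Prop).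

(* The letter (false, x) stands for x and (true, x) for its inverse. The
   defining relations rel are between words without inverse letters. *)
Inductive group_rel : seq (bool * X) -> seq (bool * X) -> Prop :=
| group_rel_def u v :
    rel u v -> group_rel [seq (false, x) | x <- u] [seq (false, x) | x <- v]
| group_rel_cancel b x : group_rel [:: (b, x); (~~ b, x)] [::].

Definition pres_group := pres_monoid group_rel.

HB.instance Definition _ := Monoid.on pres_group.

Definition pg_invw (u : seq (bool * X)) : seq (bool * X) :=
  rev [seq (~~ a.1, a.2) | a <- u].

Definition pg_inv (x : pres_group) : pres_group :=
  pm_class group_rel (pg_invw (repr x)).

Lemma pg_invwK : involutive pg_invw.
Proof.
move=> u; rewrite /pg_invw map_rev revK -map_comp map_id_in //.
by case=> b x _ /=; rewrite negbK.
Qed.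

Lemma pg_invw_cancel u : word_congr group_rel (u ++ pg_invw u) [::].
Proof.
elim: u => [|[b x] u IH]; first exact: word_congr_refl.
rewrite /pg_invw /= rev_cons -cats1 -/(pg_invw u) -cat1s catA.
have h1 := word_congr_refl group_rel [:: (b, x)].
have h2 := word_congr_refl group_rel [:: (~~ b, x)].
apply: word_congr_trans (word_congr_rel [::] [::] (group_rel_cancel b x)).
have := word_congr_cat (word_congr_cat h1 IH) h2.
by rewrite -!catA.
Qed.

Lemma pg_mulV : right_inverse (1 : pres_group) pg_inv *%g.
Proof.
move=> x; rewrite -{1}[x]reprK -/(pm_class group_rel (repr x)) /pg_inv.
by rewrite -pm_classM; apply/pm_classP/pg_invw_cancel.
Qed.

Lemma pg_Vmul : left_inverse (1 : pres_group) pg_inv *%g.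
Proof.
move=> x; rewrite -{2}[x]reprK -/(pm_class group_rel (repr x)) /pg_inv.
rewrite -pm_classM; apply/pm_classP.
by rewrite -{2}[repr x]pg_invwK; apply: pg_invw_cancel.
Qed.

HB.instance Definition _ := hasInv.Build pres_group pg_inv.
HB.instance Definition _ := Monoid_isGroup.Build pres_group pg_Vmul pg_mulV.

Definition pg_gen (x : X) : pres_group := pm_class group_rel [:: (false, x)].

End PresentedGroup.

Section AffineA.
Context (n : nat).

(* The generator s_k is represented by the ordinal of value k - 1. *)
Definition adjacent (i j : 'I_n) : bool := (j == ordS i) || (i == ordS j).

(* The entry 0 stands for infinity; the relation it gives below is trivial. *)
Definition coxeter_mx (i j : 'I_n) : nat :=
  if i == j then 1%N else
  if adjacent i j then (if n == 2 then 0 else 3) else 2.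

Inductive coxeter_rel : seq 'I_n -> seq 'I_n -> Prop :=
| CoxeterRel i j :
    coxeter_rel (flatten (nseq (coxeter_mx i j) [:: i; j])) [::].

Definition coxeter_group := pres_group coxeter_rel.
HB.instance Definition _ := Group.on coxeter_group.

Definition cox_gen (i : 'I_n) : coxeter_group := pg_gen coxeter_rel i.

Inductive artin_rel : seq 'I_n -> seq 'I_n -> Prop :=
| ArtinBraid i :
    2 < n -> artin_rel [:: i; ordS i; i] [:: ordS i; i; ordS i]
| ArtinCommute i j :
    i != j -> ~~ adjacent i j -> artin_rel [:: i; j] [:: j; i].

Definition artin_group := pres_group artin_rel.
HB.instance Definition _ := Group.on artin_group.

Definition art_gen (i : 'I_n) : artin_group := pg_gen artin_rel i.

Definition reflection (r : coxeter_group) : Prop :=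
  exists i w, r = cox_gen i ^ w.

Definition prod_of_reflections (w : coxeter_group) (k : nat) : Prop :=
  exists rs : seq coxeter_group,
    [/\ size rs = k, forall r, r \in rs -> reflection r & \prod_(r <- rs) r = w].

Lemma cox_genV i : (cox_gen i)^-1 = cox_gen i.
Proof.
suff h : cox_gen i * cox_gen i = 1.
  by rewrite -[LHS]mulg1 -h mulKg.
rewrite /cox_gen /pg_gen -pm_classM; apply/pm_classP.
have := CoxeterRel i i; rewrite /coxeter_mx eqxx => /group_rel_def.
exact: (@word_congr_rel _ _ [::] [::]).
Qed.

Lemma prod_of_reflections_ex w : exists k, `[< prod_of_reflections w k >].
Proof.
suff [rs rsP <-] : exists2 rs : seq coxeter_group,
    (forall r, r \in rs -> reflection r) & \prod_(r <- rs) r = w.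
  by exists (size rs); apply/asboolP; exists rs.
elim/pm_classW: w; elim=> [|[b i] u [rs rsP rsE]].
  by exists [::] => //; rewrite big_nil.
exists (cox_gen i :: rs).
  move=> r; rewrite inE => /predU1P[->|/rsP//].
  by exists i, 1; rewrite conjg1.
rewrite big_cons rsE -cat1s pm_classM; congr (_ * _).
case: b; last by [].
rewrite -cox_genV -[RHS]mulg1; apply: (@mulgI _ (cox_gen i)).
rewrite mulgV mulg1; apply/esym; rewrite /cox_gen /pg_gen -pm_classM.
apply/pm_classP.
exact: (word_congr_rel [::] [::] (group_rel_cancel coxeter_rel false i)).
Qed.

Definition l_R (w : coxeter_group) : nat := ex_minn (prod_of_reflections_ex w).

Definition divides (v w : coxeter_group) : Prop :=
  exists v', w = v * v' /\ l_R w = l_R v + l_R v'.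

Definition cox_c : coxeter_group := \prod_(i < n) cox_gen i.

Definition P_c : pred coxeter_group := fun w => `[< divides w cox_c >].

Definition Pc_type := {w : coxeter_group | P_c w}.
HB.instance Definition _ := SubChoice.on Pc_type.

(* The copy of 1 \in P_c is identified with the unit of the monoid; the other
   relations only make it an idempotent. *)
Inductive dual_rel : seq Pc_type -> seq Pc_type -> Prop :=
| DualMul u v w :
    val w = val u * val v -> l_R (val w) = l_R (val u) + l_R (val v) ->
    dual_rel [:: u; v] [:: w]
| DualOne u : val u = 1 -> dual_rel [:: u] [::].

Definition dual_monoid := pres_monoid dual_rel.
HB.instance Definition _ := Monoid.on dual_monoid.

Definition underline (w : Pc_type) : dual_monoid := pm_class dual_rel [:: w].

Definition in_underline_Pc (a : dual_monoid) : Prop := exists w, a = underline w.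

End AffineA.

Definition left_divides (M : monoidType) (a m : M) : Prop :=
  exists b, m = a * b.

Definition left_coprime (M : monoidType) (a b : M) : Prop :=
  forall d, left_divides d a -> left_divides d b -> d = 1.

Definition greatest_left_divisor_in (M : monoidType) (S : M -> Prop) (m a : M) :
    Prop :=
  [/\ S a, left_divides a m
    & forall d, S d -> left_divides d m -> left_divides d a].

(* The group of fractions is the enveloping group of M, given by its universal
   property. The definition requires neither that iota is injective nor that
   every element of G is a fraction. *)
Definition is_group_of_fractions (M : monoidType) (G : groupType)
    (iota : M -> G) : Prop :=
  monoid_morphism iota /\
  forall (H : groupType) (f : M -> H), monoid_morphism f ->
    exists! g : G -> H, monoid_morphism g /\ forall m, g (iota m) = f m.

(* iota identifies the Artin-Tits group with the group of fractions of the
   dual monoid, through s_i |-> underline s_i. *)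
Definition fractions_identification (n : nat)
    (iota : dual_monoid n -> artin_group n) : Prop :=
  is_group_of_fractions iota /\
  forall (i : 'I_n) (w : Pc_type n),
    val w = cox_gen i -> iota (underline w) = art_gen i.

Definition normal_form (n : nat) (m : dual_monoid n)
    (s : seq (dual_monoid n)) : Prop :=
  [/\ m = \prod_(a <- s) a,
      forall i, i < size s ->
        greatest_left_divisor_in (@in_underline_Pc n)
          (\prod_(a <- drop i s) a) (nth 1 s i)
    & 0 < size s -> last 1 s <> 1].

(* Main.v *)
(** An affine permutation w in W acts on the twisted functions x : Z -> Q,
x(z + n) = 2 x(z), and codim Fix(w) is subadditive and at most 1 on reflections;
hence codim Fix <= l_R, and additivity of lengths forces Fix(w) to lie in
Fix(v) for every divisor v of w. Order Z so that the multiples of n come last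
and in reverse order: c is then the successor map, and the divisors of c
correspond to the n-periodic noncrossing equivalence relations on Z for this
order in which an infinite class contains both multiples and non-multiples of n.
Divisibility becomes inclusion of relations. The intersection of two such
relations is again one, except that its class of the multiples of n may have to
be broken into singletons, so P_c has meets. From the meets one gets the greatest
simple left divisor and left cancellation in M(P_c), hence normal forms; an
embedding of M(P_c) in a group is built from the elements c^-k m, and the head of
x a meets the head of x b in the head of x when a and b are coprime, which gives
uniqueness of fractions. *)

From HB Require Import structures.
Require Import Defs.
From mathcomp Require Import all_boot all_order all_algebra zify ring lra boolp.

Set Implicit Arguments.
Unset Strict Implicit.
Unset Printing Implicit Defensive.

Import Order.TTheory GRing.Theory Num.Theory.

(** * Periodic noncrossing relations *)

Section NC.
Local Open Scope ring_scope.
Variable n : nat.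
Hypothesis n_gt1 : (1 < n)%N.

Notation N := (n%:Z).

Definition inner (z : int) : bool := (n %| z)%Z.

(* Multiples of n come last and in decreasing order, so that coxfun below is the
   successor map. *)
Definition slt (p q : int) : bool :=
  (inner p && inner q && (q < p)) || (~~ inner p && (inner q || (p < q))).
Definition sle (p q : int) : bool :=
  (inner p && inner q && (q <= p)) || (~~ inner p && (inner q || (p <= q))).

Lemma inner0 : inner 0. Proof. exact: dvdz0. Qed.
Lemma innerDM (p k : int) : inner (p + k * N) = inner p.
Proof. by rewrite /inner rpredDr // dvdz_mull. Qed.
Lemma innerD (p : int) : inner (p + N) = inner p.
Proof. by rewrite -[N]mul1r innerDM. Qed.
Lemma innerB (p : int) : inner (p - N) = inner p.
Proof. by rewrite -[N]mul1r -mulNr innerDM. Qed.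
Lemma innerP (p : int) : reflect (exists k, p = k * N) (inner p).
Proof. exact: dvdzP. Qed.
Lemma N_gt1 : 1 < N. Proof. by []. Qed.

Lemma mulN_ge1 (k : int) : 1 <= k -> N <= k * N. Proof. nia. Qed.
Lemma mulN_leN1 (k : int) : k <= -1 -> k * N <= - N. Proof. nia. Qed.

Ltac ord :=
  repeat match goal with
  | H : is_true (slt _ _) |- _ => revert H
  | H : is_true (sle _ _) |- _ => revert H
  | H : is_true (_ && _) |- _ => revert H
  | H : is_true (_ || _) |- _ => revert H
  | H : is_true (~~ _) |- _ => revert H
  | H : is_true (inner _) |- _ => revert H
  end; rewrite /slt /sle ?(innerDM, innerD, innerB, inner0); lia.

Definition rel_shift (R : int -> int -> Prop) :=
  forall p q k : int, R p q -> R (p + k * N) (q + k * N).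

(* nc_bal: the elements of W have total displacement 0 on a period, so infinite
   orbits on both sides must occur together; they form one class. *)
Record ncrel (R : int -> int -> Prop) : Prop := NCRel {
  nc_refl : forall p, R p p;
  nc_sym : forall p q, R p q -> R q p;
  nc_trans : forall q p r, R p q -> R q r -> R p r;
  nc_shift : rel_shift R;
  nc_cross : forall a b c d,
    slt a b -> slt b c -> slt c d -> R a c -> R b d -> R a b;
  nc_bal : forall p, R p (p + N) -> R p 0 /\ exists2 x, ~~ inner x & R p x
}.

(* b follows a in the cyclic order on the class of a. *)
Definition nextp (R : int -> int -> Prop) (a b : int) : Prop :=
  R a b /\ ((slt a b /\ forall c, R a c -> ~~ (slt a c && slt c b)) \/
            (sle b a /\ forall c, R a c -> sle b c && sle c a)).

Definition realizes (R : int -> int -> Prop) (f : int -> int) : Prop :=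
  forall a, nextp R a (f a).

Definition swap (p q z : int) : int :=
  if (n %| z - p)%Z then z - p + q else if (n %| z - q)%Z then z - q + p else z.

Lemma nextp_uniq R a b b' : nextp R a b -> nextp R a b' -> b = b'.
Proof.
move=> [Rb Hb] [Rb' Hb'].
case: Hb => -[lt1 H1]; case: Hb' => -[lt2 H2];
  move: (H1 _ Rb') (H2 _ Rb); ord.
Qed.

Lemma nextp_shift R (a b k : int) : rel_shift R ->
  nextp R a b -> nextp R (a + k * N) (b + k * N).
Proof.
move=> shR [Rab H]; split; first exact: shR.
have tr c : R (a + k * N) c -> R a (c - k * N).
  by move/shR => /(_ (- k)); rewrite mulNr addrK.
have innc (c : int) : inner (c - k * N) = inner c by rewrite -mulNr innerDM.
case: H => -[l H]; [left|right]; split; try by ord.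
- move=> c /tr /H; move: (innc c); ord.
- move=> c /tr /H; move: (innc c); ord.
Qed.

Section Rel.
Variable R : int -> int -> Prop.
Hypothesis ncR : ncrel R.

Definition unbounded p := R p (p + N).

Lemma inf_all (p k : int) : unbounded p -> R p (p + k * N).
Proof.
move=> ip.
have up (j : nat) : R p (p + j%:Z * N).
  elim: j => [|j IH]; first by rewrite mul0r addr0; apply: (nc_refl ncR).
  apply: (nc_trans ncR) IH _.
  have -> : p + j.+1%:Z * N = p + N + j%:Z * N by nia.
  exact: nc_shift.
case: k => j; first exact: up.
have /(nc_shift ncR (Negz j)) := up j.+1.
have -> : p + j.+1%:Z * N + Negz j * N = p by nia.
exact: nc_sym.
Qed.

Lemma inf_rel p q : R p q -> unbounded p -> unbounded q.
Proof.
move=> Rpq ip.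
apply: (nc_trans ncR) (nc_sym ncR Rpq) _.
apply: (nc_trans ncR) ip _.
by have := nc_shift ncR 1 Rpq; rewrite mul1r.
Qed.

Lemma inf_ex (p k : int) : k != 0 -> R p (p + k * N) -> unbounded p.
Proof.
have pos (j : int) : 1 <= j -> R p (p + j * N) -> unbounded p.
  move=> j1 H; have H1 : R (p + N) (p + N + j * N).
    by have := nc_shift ncR 1 H; rewrite mul1r addrAC.
  have [e|j2] : j = 1 \/ 2 <= j by lia.
    by move: H; rewrite e mul1r.
  have jN : N + N <= j * N by nia.
  have N1 := N_gt1.
  case: (boolP (inner p)) => ip.
    have l1 : slt (p + N + j * N) (p + j * N) by ord.
    have l2 : slt (p + j * N) (p + N) by ord.
    have l3 : slt (p + N) p by ord.
    apply: nc_trans (H) _ => //; apply: nc_trans (nc_sym ncR H1) => //.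
    apply: nc_sym => //.
    apply: (nc_cross ncR l1 l2 l3); exact: nc_sym.
  apply: (nc_cross ncR (c := p + j * N) (d := p + N + j * N)) => //; ord.
move=> k0; have [k1|k1] : 1 <= k \/ 1 <= - k by lia.
  exact: pos.
move=> /(nc_shift ncR (- k)); rewrite -addrA -mulrDl addrN mul0r addr0.
by move/(nc_sym ncR); apply: pos.
Qed.

Lemma outer_bound p q : ~ unbounded p -> ~~ inner p -> ~~ inner q -> R p q ->
  q < p + N.
Proof.
move=> nip op oq Rpq; rewrite ltNge; apply/negP => le; apply: nip.
have N1 := N_gt1.
have H1 : R (p + N) (q + N) by have := nc_shift ncR 1 Rpq; rewrite mul1r.
have [e|l] : p + N = q \/ p + N < q by lia.
  by rewrite /unbounded e.
apply: (nc_cross ncR (c := q) (d := q + N)) => //; ord.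
Qed.

Lemma inner_eq p q : ~ unbounded p -> inner p -> inner q -> R p q -> p = q.
Proof.
move=> nip /innerP[i pE] /innerP[j qE] Rpq; apply: contrapT => pq; apply: nip.
apply: (@inf_ex p (j - i)); first by apply: contra_not_neq pq; lia.
suff -> : p + (j - i) * N = q by [].
lia.
Qed.

Lemma nosep p e s t : R p e -> R s t -> sle p s && sle s e ->
  ~~ (sle p t && sle t e) -> R s p.
Proof.
move=> Rpe Rst sI tI.
have [->|sp] := eqVneq s p; first exact: nc_refl.
have [->|se] := eqVneq s e; first exact: nc_sym.
have [l|l] : slt t p \/ slt e t by ord.
  have Rts := nc_sym ncR Rst.
  apply: nc_trans (Rst) _ => //.
  apply: (nc_cross ncR l _ _ Rts Rpe); ord.
apply: nc_sym => //.
apply: (nc_cross ncR _ _ l Rpe Rst); ord.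
Qed.

End Rel.

Definition cutarc (p e k s : int) := sle (p + k * N) s && sle s (e + k * N).
Definition cutrel R p e (s t : int) : Prop :=
  R s t /\ forall k, cutarc p e k s = cutarc p e k t.

Lemma arc_shift (p e k j s : int) : cutarc p e (k + j) (s + j * N) = cutarc p e k s.
Proof. by rewrite /cutarc mulrDl !addrA; ord. Qed.

Lemma arc0 p e s : cutarc p e 0 s = sle p s && sle s e.
Proof. by rewrite /cutarc mul0r !addr0. Qed.

Lemma nosep_arc R p e s t k : ncrel R -> R p e -> R s t ->
  cutarc p e k s != cutarc p e k t -> R s (p + k * N).
Proof.
move=> ncR Rpe Rst.
have Rpek := nc_shift ncR k Rpe.
rewrite /cutarc; case: (boolP (_ && _)) => sI; case: (boolP (_ && _)) => tI // _.
  exact: (nosep ncR Rpek Rst sI tI).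
apply: (nc_trans ncR Rst).
exact: (nosep ncR Rpek (nc_sym ncR Rst) tI sI).
Qed.

Lemma int_window (z : int) : exists k : int, k * N <= z < k * N + N.
Proof.
exists (z %/ N)%Z; have N1 := N_gt1.
have zE := divz_eq z N.
have z0 : 0 <= (z %% N)%Z by apply: modz_ge0; lia.
have zN : (z %% N)%Z < N by apply: ltz_pmod; lia.
by apply/andP; split; lia.
Qed.

Lemma int_min (P : int -> Prop) (b x0 : int) : P x0 ->
  (forall x, P x -> b <= x) -> exists2 m, P m & forall x, P x -> m <= x.
Proof.
move=> Px0 Pb; pose Q (j : nat) := `[< P (b + j%:Z) >].
have PQ x : P x -> exists2 j, Q j & x = b + j%:Z.
  move=> Px; have bx := Pb _ Px; exists (absz (x - b)); last by lia.
  by apply/asboolP; have -> : b + (absz (x - b))%:Z = x by lia.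
have exQ : exists j, Q j by have [j Qj _] := PQ _ Px0; exists j.
exists (b + (ex_minn exQ)%:Z); case: ex_minnP => m Qm minm.
  exact/asboolP.
by move=> x /PQ[j /minm + ->]; lia.
Qed.

Lemma int_max (P : int -> Prop) (b x0 : int) : P x0 ->
  (forall x, P x -> x <= b) -> exists2 m, P m & forall x, P x -> x <= m.
Proof.
move=> Px0 Pb; have [||m Pm H] := @int_min (P \o -%R) (- b) (- x0).
- by rewrite /= opprK.
- by move=> x /Pb; lia.
by exists (- m) => // x; rewrite -[x]opprK => /H; lia.
Qed.

Lemma block_hull R s : ncrel R -> ~ unbounded R s ->
  exists p e, [/\ R s p, R s e & forall c, R s c -> sle p c && sle c e].
Proof.
move=> ncR ns; have N1 := N_gt1.
have nR x : R s x -> ~ unbounded R x by move=> Rsx /(inf_rel ncR (nc_sym ncR Rsx)).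
have [[x0 [ox0 Rx0]]|no] := pselect (exists x, ~~ inner x /\ R s x); last first.
  have is_ c : R s c -> inner c.
    by move=> Rsc; apply: contraT => oc; case: no; exists c.
  have iss := is_ _ (nc_refl ncR s).
  exists s, s; split; [exact: nc_refl|exact: nc_refl|].
  move=> c Rsc; have <- := inner_eq ncR ns iss (is_ _ Rsc) Rsc; ord.
have Rx x : R s x -> R x0 x by apply: nc_trans (nc_sym ncR Rx0).
have lob x : ~~ inner x -> R s x -> x0 - N <= x.
  move=> ox Rsx; have := outer_bound ncR (nR _ Rsx) ox ox0 (nc_sym ncR (Rx _ Rsx)).
  lia.
have hib x : ~~ inner x -> R s x -> x <= x0 + N.
  move=> ox Rsx; have := outer_bound ncR (nR _ Rx0) ox0 ox (Rx _ Rsx); lia.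
have [||p [op Rp] minp] := @int_min (fun x => ~~ inner x /\ R s x) (x0 - N) x0.
- by [].
- by move=> x []; apply: lob.
exists p; have [[y [iy Ry]]|nin] := pselect (exists y, inner y /\ R s y).
  exists y; split=> // c Rsc.
  have [ic|oc] := boolP (inner c); last by have := minp _ (conj oc Rsc); ord.
  suff -> : c = y by ord.
  exact: inner_eq (nR _ Rsc) _ _ (nc_trans ncR (nc_sym ncR Rsc) Ry).
have [||e [oe Re] maxe] := @int_max (fun x => ~~ inner x /\ R s x) (x0 + N) x0.
- by [].
- by move=> x []; apply: hib.
exists e; split=> // c Rsc; have oc : ~~ inner c.
  by apply/negP => ic; apply: nin; exists c.
by have := minp _ (conj oc Rsc); have := maxe _ (conj oc Rsc); ord.
Qed.

Lemma realizes_shift R f (a k : int) : ncrel R -> realizes R f ->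
  f (a + k * N) = f a + k * N.
Proof.
move=> ncR rf; apply: nextp_uniq (rf _) _.
exact: nextp_shift (nc_shift ncR) (rf a).
Qed.

Lemma inf_next R f a : ncrel R -> realizes R f -> unbounded R a -> slt a (f a).
Proof.
move=> ncR rf ia; have N1 := N_gt1.
case: (rf a) => _ [[]//|[l H]].
have H1 := H _ ia.
have ia' : R a (a - N) by have := inf_all ncR (-1) ia; rewrite mulN1r.
have H2 := H _ ia'.
ord.
Qed.

Section Split.
Variables (R : int -> int -> Prop) (f : int -> int) (p e g : int).
Hypotheses (ncR : ncrel R) (rf : realizes R f) (finj : injective f).
Hypotheses (Rpe : R p e) (lpe : sle p e) (fg : f g = p).
Hypothesis ph : ~~ (n %| p - f e)%Z.
Hypothesis outer_small : unbounded R p -> ~~ inner e -> e < p + N.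

Let h := f e.
Let R' := cutrel R p e.

Lemma split_phN (k : int) : p != h + k * N.
Proof.
apply: contraNneq ph => ->; rewrite [h + _]addrC addrK.
exact: dvdz_mull.
Qed.

Lemma split_inner_ph : ~~ (inner p && inner h).
Proof.
apply/negP => /andP[ip ih]; case/negP: ph.
by rewrite rpredB.
Qed.

Lemma split_Rph : R p h.
Proof. by apply: nc_trans Rpe _ => //; case: (rf e). Qed.

Lemma split_Rgp : R g p.
Proof. by rewrite -fg; case: (rf g). Qed.

Lemma split_Ng : nextp R g p. Proof. by rewrite -fg; apply: rf. Qed.

Lemma inf_split_outer : unbounded R p -> ~~ inner e ->
  [/\ ~~ inner p, ~~ inner h, e < h & h < p + N].
Proof.
move=> ip oe; have ep := outer_small ip oe; have N1 := N_gt1.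
have ie : unbounded R e by apply: inf_rel ip.
have eh := inf_next ncR rf ie; rewrite -/h in eh.
have Rep : R e (p + N) by apply: nc_trans (nc_sym ncR Rpe) ip.
have phN := split_phN (-1).
case: (rf e); rewrite -/h => _ [[_ H]|[l _]]; last by ord.
by have H1 := H _ Rep; split; ord.
Qed.

Lemma inf_split_inner : unbounded R p -> inner e -> ~~ inner p /\ h = e - N.
Proof.
move=> ip ie; have N1 := N_gt1; have ine : unbounded R e by apply: inf_rel ip.
have eh := inf_next ncR rf ine; rewrite -/h in eh.
have ih : inner h by ord.
split; first by have := split_inner_ph; rewrite ih andbT.
have Ree : R e (e - N) by have := inf_all ncR (-1) ine; rewrite mulN1r.
case: (rf e); rewrite -/h => _ [[_ H]|[l _]]; last by ord.
have := H _ Ree.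
have /innerP[i eE] := ie; have /innerP[j hE] := ih.
suff : ~ (h < e - N) -> h < e -> h = e - N by ord.
rewrite eE hE => l1 l2.
have : j < i by nia. nia.
Qed.

Lemma split_self : R' p e.
Proof.
split=> // k; have N1 := N_gt1.
have [->|k0] := eqVneq k 0; first by rewrite !arc0; ord.
apply/eqP; apply: contrapT => /negP sep.
have ip : unbounded R p.
  apply: inf_ex k0 _ => //.
  exact: nosep_arc sep.
move: sep => /negP/negP; apply/negP; rewrite negbK; apply/eqP.
have kN : k * N <= - N \/ N <= k * N by nia.
case: (boolP (inner e)) => ie.
  have [op _] := inf_split_inner ip ie.
  by rewrite /cutarc; ord.
have [op _ _ _] := inf_split_outer ip ie.
have := outer_small ip ie.
by rewrite /cutarc; ord.
Qed.

Lemma split_g0 : ~~ cutarc p e 0 g.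
Proof.
rewrite arc0; apply/negP => l.
case: split_Ng => _ [[l' _]|[l' H]]; first by ord.
have ge : g = e by have := H _ (nc_trans ncR split_Rgp Rpe); ord.
by have := split_phN 0; rewrite mul0r addr0 /h -ge fg eqxx.
Qed.

Lemma split_h0 : ~~ cutarc p e 0 h.
Proof.
rewrite arc0; apply/negP => l.
have := split_phN 0; rewrite mul0r addr0 => ne.
case: (rf e); rewrite -/h => _ [[l' _]|[l' H]]; first by ord.
by have := H _ (nc_sym ncR Rpe); ord.
Qed.

Lemma split_gh : R' g h.
Proof.
have Rgh : R g h by apply: nc_trans split_Rph => //; apply: split_Rgp.
split=> // k; have N1 := N_gt1.
have [->|k0] := eqVneq k 0.
  by rewrite (negbTE split_g0) (negbTE split_h0).
apply/eqP; apply: contrapT => /negP sep.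
have ip : unbounded R p.
  apply: inf_ex k0 _ => //.
  apply: nc_trans (nc_sym ncR split_Rgp) _ => //.
  exact: nosep_arc sep.
move: sep => /negP/negP; apply/negP; rewrite negbK; apply/eqP.
have kN : k * N <= - N \/ N <= k * N by nia.
have ig : unbounded R g := inf_rel ncR (nc_sym ncR split_Rgp) ip.
have gp := inf_next ncR rf ig; rewrite fg in gp.
have Rgp := split_Rgp.
have Hg : forall c, R g c -> ~~ (slt g c && slt c p).
  by case: split_Ng => _ [[_ H]|[l _]] //; ord.
case: (boolP (inner e)) => ie.
  have [op hE] := inf_split_inner ip ie.
  have Rgp' : R g (p - N).
    by have := inf_all ncR (-1) ip; rewrite mulN1r; apply: nc_trans.
  have := Hg _ Rgp'; rewrite hE /cutarc; ord.
have [op oh eh hp] := inf_split_outer ip ie.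
have Rge : R g (e - N).
  have := inf_all ncR (-1) (inf_rel ncR Rpe ip); rewrite mulN1r.
  by apply: nc_trans (nc_trans ncR Rgp Rpe).
have ge : g != e - N.
  apply: contra_eq_neq fg => ->.
  have := realizes_shift e (-1) ncR rf; rewrite mulN1r => ->.
  have := split_phN (-1); rewrite mulN1r eq_sym; exact.
have := Hg _ Rge; rewrite /cutarc; ord.
Qed.

Lemma next_split_e : nextp R' e p.
Proof.
split; first by case: split_self => H1 H2; split; [apply: nc_sym|].
right; split=> // c [_ /(_ 0)]; rewrite !arc0; ord.
Qed.

Lemma next_split_g : nextp R' g h.
Proof.
split; first exact: split_gh.
have Rgp := split_Rgp; have g0 := split_g0; have h0 := split_h0.
rewrite !arc0 in g0 h0.
have Nh : nextp R e h := rf e.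
have Reg : R e g by apply: nc_trans (nc_sym ncR Rpe) (nc_sym ncR Rgp).
have Rgh : R g h by case: split_gh.
have tr c : R' g c -> [/\ R g c, R e c & ~~ (sle p c && sle c e)].
  move=> [Rgc /(_ 0)]; rewrite !arc0 (negbTE g0) => <-; split=> //.
  exact: nc_trans Rgc.
have := split_phN 0; rewrite mul0r addr0 => phn.
have Rgp' := nc_sym ncR Rgp.
case: split_Ng => _ [[gp Hg]|[pg Hg]]; case: Nh => _ [[eh Hh]|[he Hh]].
- left; split; first by ord.
  by move=> c /tr[/Hg + /Hh]; ord.
- right; split; first by have := Hh _ Reg; ord.
  by move=> c /tr[/Hg + /Hh]; ord.
- right; split; first by have := Hg _ Rgh; ord.
  by move=> c /tr[/Hg + /Hh]; ord.
- by have := Hh _ (nc_sym ncR Rpe); have := Hg _ Rgh; ord.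
Qed.

Lemma split_shift (s t k : int) : R' s t -> R' (s + k * N) (t + k * N).
Proof.
move=> [Rst H]; split; first exact: nc_shift.
by move=> j; have := H (j - k); rewrite -(arc_shift _ _ _ k) -(arc_shift _ _ _ k t) subrK.
Qed.

Lemma split_sep1 s t : nextp R s t -> cutarc p e 0 s != cutarc p e 0 t ->
  t = p \/ s = e.
Proof.
move=> [Rst H] sep; have := nosep_arc ncR Rpe Rst sep.
rewrite mul0r addr0 => Rsp; have Rse := nc_trans ncR Rsp Rpe.
move: sep; rewrite !arc0.
case: H => -[l H]; have := H _ Rsp; have := H _ Rse; ord.
Qed.

Lemma split_realizes : realizes R' (swap p h \o f).
Proof.
have nsh a b k := @nextp_shift R' a b k split_shift.
move=> s; rewrite /comp /swap; case: dvdzP => [[k E]|np].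
  have {E} fs : f s = p + k * N by lia.
  have sE : s = g + k * N by apply: finj; rewrite (realizes_shift _ _ ncR rf) fg.
  have -> : f s - p + h = h + k * N by lia.
  by rewrite sE; apply/nsh/next_split_g.
case: dvdzP => [[k E]|nh].
  have {E} fs : f s = h + k * N by lia.
  have sE : s = e + k * N by apply: finj; rewrite (realizes_shift _ _ ncR rf).
  have -> : f s - h + p = p + k * N by lia.
  by rewrite sE; apply/nsh/next_split_e.
have [Rst H] := rf s.
split; last first.
  case: H => -[l H]; [left|right]; split=> // c [Rsc _]; exact: H.
split=> // k; apply/eqP; apply: contrapT => /negP sep.
have Nk : nextp R (s - k * N) (f s - k * N).
  by rewrite -mulNr; apply: nextp_shift (nc_shift ncR) (rf s).
have [] := split_sep1 Nk.
- move: sep; rewrite -(arc_shift p e 0 k (s - _)) -(arc_shift p e 0 k (f s - _)).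
  by rewrite add0r !subrK.
- by move=> E; case: np; exists k; lia.
- move=> E; case: nh; exists k.
  have -> : s = e + k * N by lia.
  by rewrite (realizes_shift _ _ ncR rf); lia.
Qed.

Lemma split_cross a b c d : slt a b -> slt b c -> slt c d ->
  R' a c -> R' b d -> R' a b.
Proof.
move=> ab bc cd [Rac Hac] [Rbd Hbd]; split; first exact: nc_cross Rac Rbd.
by move=> k; have := Hac k; have := Hbd k; rewrite /cutarc; ord.
Qed.

Lemma split_out q t : (forall k : int, ~ R q (p + k * N)) -> R q t -> R' q t.
Proof.
move=> nqp Rqt; split=> // k; apply/eqP; apply: contrapT => /negP sep.
by apply: (nqp k); apply: nosep_arc sep.
Qed.

Lemma split_ninf_inner : unbounded R p -> inner e -> forall q, ~ unbounded R' q.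
Proof.
move=> ip ie q [Rqq sep].
have [op _] := inf_split_inner ip ie; have N1 := N_gt1.
have [iq|oq] := boolP (inner q).
  have [i eE] := innerP _ ie; have [j qE] := innerP _ iq.
  have := sep (j - i + 1); rewrite /cutarc.
  have -> : e + (j - i + 1) * N = q + N by lia.
  ord.
have [k /andP[k1 k2]] := int_window (q - p).
have := sep (k + 1); rewrite /cutarc mulrDl mul1r !addrA.
ord.
Qed.

Lemma inf_arc q : unbounded R p -> ~~ inner e -> unbounded R' q ->
  forall k, ~~ cutarc p e k q.
Proof.
move=> ip oe [Rqq sep] k; have := sep k.
have [op oh eh hp] := inf_split_outer ip oe; have N1 := N_gt1.
have [iq|oq] := boolP (inner q); first by rewrite /cutarc; ord.
by rewrite /cutarc; ord.
Qed.

Lemma split_ninf_e : ~ unbounded R' e.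
Proof.
move=> ie'; have ip : unbounded R p.
  by apply: inf_rel (nc_sym ncR Rpe) _; case: ie'.
have [ie|oe] := boolP (inner e); first exact: split_ninf_inner ie'.
by have := inf_arc ip oe ie' 0; rewrite arc0; ord.
Qed.

Lemma split_strict : R e h /\ ~ R' e h.
Proof.
split; first by case: (rf e).
move=> [_ /(_ 0)]; rewrite (negbTE split_h0) arc0; ord.
Qed.

Lemma split_nc : ncrel R'.
Proof.
split.
- by move=> q; split=> //; apply: nc_refl.
- by move=> q t [Rqt H]; split; first exact: nc_sym.
- by move=> q t r [Rqt H] [Rtr H']; split;
  [apply: nc_trans Rqt Rtr|move=> k; rewrite H].
- exact: split_shift.
- exact: split_cross.
move=> q iq; have iRq : unbounded R q by case: iq.
have [R0 [x ox Rx]] := nc_bal ncR iRq.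
have [ip|nip] := pselect (unbounded R p); last first.
  have nqp (k : int) : ~ R q (p + k * N).
    move=> Rqp; apply: nip; have := inf_rel ncR Rqp iRq.
    move=> /(nc_shift ncR (- k)); rewrite mulNr addrK.
    by have -> : p + k * N + N - k * N = p + N by lia.
  by split; [|exists x => //]; apply: split_out.
have [ie|oe] := boolP (inner e); first by case: (split_ninf_inner ip ie iq).
have qa := inf_arc ip oe iq.
have [op oh eh hp] := inf_split_outer ip oe; have N1 := N_gt1.
have [Rp0 _] := nc_bal ncR ip.
split; last exists h => //.
- by split=> // k; rewrite (negbTE (qa k)) /cutarc; ord.
- split=> [|k]; last first.
    have kN : k * N <= 0 \/ N <= k * N.
      by case: (leP k 0) => k0; [left|right]; nia.
    by rewrite (negbTE (qa k)) /cutarc; ord.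
  apply: nc_trans R0 _ => //; apply: nc_trans (nc_sym ncR Rp0) _ => //.
  exact: split_Rph.
Qed.

End Split.

Definition cut R f p e :=
  [/\ R p e, sle p e, ~~ (n %| p - f e)%Z
    & unbounded R p -> ~~ inner e -> e < p + N].

Section Refine.
Variables (R R1 : int -> int -> Prop) (f : int -> int).
Hypotheses (ncR : ncrel R) (ncR1 : ncrel R1) (rf : realizes R f).
Hypothesis sub1 : forall a b, R1 a b -> R a b.

Lemma hull_split s p e : R1 s p -> R1 s e ->
  (forall c, R1 s c -> sle p c && sle c e) ->
  forall a b, R1 a b -> cutrel R p e a b.
Proof.
move=> sp se H a b ab; split; first exact: sub1.
have inarc c (k : int) : R1 c (p + k * N) -> cutarc p e k c.
  move=> cp; rewrite -[k]add0r -(subrK (k * N) c) arc_shift arc0; apply: H.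
  apply: nc_trans sp _ => //; apply: nc_sym => //.
  by have := nc_shift ncR1 (- k) cp; rewrite !mulNr addrK.
have R1pe := nc_trans ncR1 (nc_sym ncR1 sp) se.
move=> k; apply/eqP; apply: contrapT => /negP sep.
have ap := nosep_arc ncR1 R1pe ab sep.
have bp := nc_trans ncR1 (nc_sym ncR1 ab) ap.
by move: sep; rewrite !inarc ?eqxx.
Qed.

Lemma finite_cut s p e b : ~ unbounded R s -> R s p -> R1 p e -> sle p e ->
  R s b -> ~~ (sle p b && sle b e) -> cut R f p e.
Proof.
move=> ns sp /sub1 pe lpe sb nb.
have np : ~ unbounded R p by move/(inf_rel ncR (nc_sym ncR sp)).
split=> //; apply/dvdzP => -[k E].
have fE : f e = p + (- k) * N by lia.
have [Re He] := rf e.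
have k0 : - k = 0.
  apply: contrapT => /eqP k0; apply: np; apply: (inf_ex ncR k0).
  by rewrite -fE; apply: nc_trans Re.
move: fE He; rewrite k0 mul0r addr0 => -> [[] |[_ H]]; first by ord.
move: nb; rewrite H //; apply: nc_trans (nc_sym ncR pe) _ => //.
exact: nc_trans (nc_sym ncR sp) sb.
Qed.

Lemma refine_cut_fin s t : ~ unbounded R s -> R s t -> ~ R1 s t ->
  exists p e, cut R f p e /\ forall a b, R1 a b -> cutrel R p e a b.
Proof.
move=> ns st n1.
have nt : ~ unbounded R t by move/(inf_rel ncR (nc_sym ncR st)).
have [p [e [sp se H]]] : exists p e, [/\ R1 s p, R1 s e &
    forall c, R1 s c -> sle p c && sle c e].
  by apply: (block_hull ncR1) => i1; apply: ns; apply: sub1.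
have [p' [e' [tp te H']]] : exists p e, [/\ R1 t p, R1 t e &
    forall c, R1 t c -> sle p c && sle c e].
  by apply: (block_hull ncR1) => i1; apply: nt; apply: sub1.
have pe := nc_trans ncR1 (nc_sym ncR1 sp) se.
have pe' := nc_trans ncR1 (nc_sym ncR1 tp) te.
have [[b [sb nb]]|all] := pselect (exists b, R s b /\ ~~ (sle p b && sle b e)).
  exists p, e; split; last exact: (hull_split sp se H).
  by apply: (finite_cut ns (sub1 sp) pe _ sb nb); case/andP: (H _ se).
exists p', e'; split; last exact: (hull_split tp te H').
have tp' := nc_trans ncR st (sub1 tp).
apply: (finite_cut ns tp' pe' _ (sub1 sp)); first by case/andP: (H' _ te).
apply/negP => /andP[l _].
have l' : sle p p'.
  apply: contraT => l'; case: all; exists p'; split=> //.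
  by rewrite (negbTE l').
apply: n1; apply: nc_trans sp _ => //; apply: nc_sym => //.
suff -> : p = p' by [].
ord.
Qed.

Lemma refine_cut_inf u : unbounded R 0 -> unbounded R1 0 -> R u 0 -> ~ R1 u 0 ->
  exists p e, cut R f p e /\ forall a b, R1 a b -> cutrel R p e a b.
Proof.
move=> i0 i10 u0 n1; have N1 := N_gt1.
have nu : ~ unbounded R1 u by move=> /(nc_bal ncR1)[].
have [p [e [up ue H]]] := block_hull ncR1 nu.
have oc c : R1 u c -> ~~ inner c.
  move=> uc; apply/negP => /innerP[k cE]; apply: n1.
  apply: nc_trans uc _ => //; apply: nc_sym => //.
  by have := inf_all ncR1 k i10; rewrite add0r -cE.
have pe := nc_trans ncR1 (nc_sym ncR1 up) ue.
have np : ~ unbounded R1 p by move/(inf_rel ncR1 (nc_sym ncR1 up)).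
have ep := outer_bound ncR1 np (oc _ up) (oc _ ue) pe.
have [op oe] := (oc _ up, oc _ ue).
have lpe : sle p e by case/andP: (H _ ue).
exists p, e; split; last exact: (hull_split up ue H).
split=> //; first exact: sub1.
apply/dvdzP => -[k E].
have fE : f e = p + (- k) * N by lia.
have Re0 : R e 0 := nc_trans ncR (nc_sym ncR (sub1 ue)) u0.
have Rp0 : R p 0 := nc_trans ncR (nc_sym ncR (sub1 up)) u0.
have ip : unbounded R p := inf_rel ncR (nc_sym ncR Rp0) i0.
have ie : unbounded R e := inf_rel ncR (nc_sym ncR Re0) i0.
have eh := inf_next ncR rf ie.
have He : forall c, R e c -> ~~ (slt e c && slt c (f e)).
  by case: (rf e) => _ [[_ H0]|[l _]] //; ord.
have hE : f e = p + N.
  have := He (p + N) (nc_trans ncR (nc_sym ncR (sub1 pe)) ip).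
  have [k0|k1] : - k <= 0 \/ 1 <= - k by lia.
    have : - k * N <= 0 by nia.
    by move: eh; rewrite fE; ord.
  have : N <= - k * N by nia.
  by move: eh; rewrite fE; ord.
have [_ [x ox R10x]] := nc_bal ncR1 i10.
have [j /andP[j1 j2]] := int_window (x - p).
pose y := x - j * N.
have oy : ~~ inner y by rewrite /y -mulNr innerDM.
have iy : R1 0 y.
  have := nc_shift ncR1 (- j) R10x; rewrite add0r mulNr.
  apply: nc_trans => //; rewrite -mulNr.
  by have := inf_all ncR1 (- j) i10; rewrite add0r.
have ny c : R1 u c -> y != c.
  move=> uc; apply: contra_not_neq n1 => yc; apply: nc_trans uc _ => //.
  by rewrite -yc; apply: nc_sym.
have yp := ny _ up; have ye := ny _ ue.
have := He y (nc_trans ncR Re0 (sub1 iy)); rewrite hE.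
have y1 : p <= y < p + N by rewrite /y; lia.
have [l1 l2] : slt p y /\ (slt y e \/ slt e y) by split; ord.
case: l2 => l2 Hy; last by ord.
have l3 : slt e 0 by ord.
have py := nc_cross ncR1 l1 l2 l3 pe (nc_sym ncR1 iy).
by have := ny _ (nc_trans ncR1 up py); rewrite eqxx.
Qed.

Lemma refine_cut_mix x y :
  unbounded R 0 -> ~ unbounded R1 0 -> ~~ inner x -> inner y ->
  R1 x y -> R x 0 ->
  exists p e, cut R f p e /\ forall a b, R1 a b -> cutrel R p e a b.
Proof.
move=> i0 ni ox iy xy x0.
have nx : ~ unbounded R1 x.
  by move=> ix; apply: ni; exact: (inf_rel ncR1 (proj1 (nc_bal ncR1 ix)) ix).
have [p [e [xp xe H]]] := block_hull ncR1 nx.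
have [l1 l2] : sle p x /\ sle y e.
  by split; [case/andP: (H _ (nc_refl ncR1 x))|case/andP: (H _ xy)].
have [op ie] : ~~ inner p /\ inner e by split; ord.
exists p, e; split; last exact: (hull_split xp xe H).
have pe := nc_trans ncR1 (nc_sym ncR1 xp) xe.
split; [exact: sub1|by case/andP: (H _ xe)| |by rewrite ie].
have ine : unbounded R e.
  exact: (inf_rel ncR (nc_trans ncR (nc_sym ncR x0) (sub1 xe)) i0).
have := inf_next ncR rf ine => eh.
have ih : inner (f e) by ord.
by apply: contra op => d; rewrite -(subrK (f e) p) /inner rpredD.
Qed.

Lemma refine_cut_out : unbounded R 0 -> ~ unbounded R1 0 ->
  (forall x y, ~~ inner x -> inner y -> ~ R1 x y) ->
  exists p e, cut R f p e /\ forall a b, R1 a b -> cutrel R p e a b.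
Proof.
move=> i0 ni nxy; have N1 := N_gt1.
have nin q : ~ unbounded R1 q.
  by move=> iq; apply: ni; exact: (inf_rel ncR1 (proj1 (nc_bal ncR1 iq)) iq).
have [_ [x0 ox0 R0x0]] := nc_bal ncR i0.
pose P s := ~~ inner s /\ exists t, [/\ ~~ inner t, s <= x0, x0 <= t & R1 s t].
have [||p [op [t [ot px0 x0t pt]]] minp] := @int_min P (x0 - N) x0.
- by split=> //; exists x0; split=> //; apply: nc_refl.
- move=> s [os [t [ot sx xt st]]].
  by have := outer_bound ncR1 (nin s) os ot st; lia.
have unc a b : ~~ inner a -> ~~ inner b -> a < p <= b -> ~ R1 a b.
  move=> oa ob /andP[ap pb] ab.
  have nPa : ~ P a by move/minp; lia.
  have [bx|xb] := leP x0 b.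
    by apply: nPa; split=> //; exists b; split=> //; lia.
  apply: nPa; split=> //; exists t; split=> //; first by lia.
  have [bp|bp] := eqVneq b p; first by apply: nc_trans pt => //; rewrite -bp.
  have l1 : slt a p by ord.
  have l2 : slt p b by ord.
  have l3 : slt b t by ord.
  exact: nc_trans (nc_cross ncR1 l1 l2 l3 ab pt) pt.
have Rx00 := nc_sym ncR R0x0; have Rpt := sub1 pt.
have Rp0 : R p 0.
  have [->//|px] := eqVneq p x0.
  have [tx|tx] := eqVneq t x0; first by apply: nc_trans Rx00 => //; rewrite -tx.
  have l1 : slt p x0 by ord.
  have l2 : slt x0 t by ord.
  have l3 : slt t 0 by ord.
  exact: nc_trans (nc_cross ncR l1 l2 l3 Rpt Rx00) Rx00.
exists p, 0; split; last first.
  have unc' a b (k : int) : ~~ inner a -> ~~ inner b ->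
      a < p + k * N <= b -> ~ R1 a b.
    move=> oa ob l /(nc_shift ncR1 (- k)); rewrite mulNr.
    by apply: unc; rewrite -?mulNr ?innerDM //; lia.
  move=> a b ab; split=> [|k]; first exact: sub1.
  have ba := nc_sym ncR1 ab.
  case: (boolP (inner a)) => [ia|oa]; case: (boolP (inner b)) => [ib|ob].
  - by rewrite (inner_eq ncR1 (nin a) ia ib ab).
  - by case: (nxy _ _ ob ia).
  - by case: (nxy _ _ oa ib).
  have H1 : ~~ (a < p + k * N <= b) by apply/negP => /(unc' _ _ _ oa ob).
  have H2 : ~~ (b < p + k * N <= a) by apply/negP => /(unc' _ _ _ ob oa).
  by rewrite /cutarc; ord.
split=> //; [by ord| |by rewrite inner0].
have eh := inf_next ncR rf i0.
have ih : inner (f 0) by ord.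
by apply: contra op => d; rewrite -(subrK (f 0) p) /inner rpredD.
Qed.

Lemma refine_cut s t : R s t -> ~ R1 s t ->
  exists p e, cut R f p e /\ forall a b, R1 a b -> cutrel R p e a b.
Proof.
move=> st n1; have [is_|ns] := pselect (unbounded R s);
  last exact: refine_cut_fin st n1.
have Rs0 := proj1 (nc_bal ncR is_).
have i0 := inf_rel ncR Rs0 is_.
have Rt0 := nc_trans ncR (nc_sym ncR st) Rs0.
have [i10|ni] := pselect (unbounded R1 0).
  have [s0|ns0] := pselect (R1 s 0); last exact: refine_cut_inf ns0.
  apply: (refine_cut_inf i0 i10 Rt0) => t0; apply: n1.
  exact: nc_trans s0 (nc_sym ncR1 t0).
have [[x [y [ox iy xy]]]|no] :=
  pselect (exists x y, [/\ ~~ inner x, inner y & R1 x y]).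
  apply: (refine_cut_mix i0 ni ox iy xy).
  apply: nc_trans (sub1 xy) _ => //; apply: nc_sym => //.
  by have /innerP[k ->] := iy; have := inf_all ncR k i0; rewrite add0r.
by apply: refine_cut_out => // x y ox iy xy; apply: no; exists x, y.
Qed.

End Refine.

Lemma swapC p q : ~~ (n %| p - q)%Z -> swap p q =1 swap q p.
Proof.
move=> pq z; rewrite /swap; case: ifP => // zp; case: ifP => // zq.
case/negP: pq; have -> : p - q = (z - q) - (z - p) by lia.
by rewrite rpredB.
Qed.

Lemma realizes_ext R f f' : f =1 f' -> realizes R f -> realizes R f'.
Proof. by move=> ff' H a; rewrite -ff'. Qed.

Lemma swap_realizes R f p q : ncrel R -> realizes R f -> bijective f ->
  R p q -> ~~ (n %| p - q)%Z ->
  (unbounded R p -> ~~ inner p -> ~~ inner q -> `|p - q| < N) ->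
  exists R', [/\ ncrel R', realizes R' (swap p q \o f) & forall a b, R' a b ->
    R a b].
Proof.
move=> ncR rf [fi fK fiK].
wlog : p q / slt p q => [wl|lt_pq] Rpq npq small.
  have pq : p != q by apply: contraNneq npq => ->; rewrite subrr dvdz0.
  have [l|l] : slt p q \/ slt q p by ord.
    exact: wl.
  have npq' : ~~ (n %| q - p)%Z by rewrite -opprB rpredN.
  have [|R' [nc' rl' sub']] := wl q p l (nc_sym ncR Rpq) npq'.
    move=> iq oq op; rewrite distrC; apply: small => //.
    exact: (inf_rel ncR (nc_sym ncR Rpq) iq).
  exists R'; split=> //; apply: realizes_ext rl' => z /=.
  exact: swapC.
pose e := fi q; have fe : f e = q by rewrite /e fiK.
have [Req He] := rf e; rewrite fe in Req He.
have Rpe := nc_trans ncR Rpq (nc_sym ncR Req).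
have [eq lpe] : slt e q /\ sle p e.
  by case: He => -[l H]; have := H _ (nc_sym ncR Rpe); split; ord.
have npe : ~~ (n %| p - f e)%Z by rewrite fe.
have sm : unbounded R p -> ~~ inner e -> e < p + N.
  move=> ip oe; have N1 := N_gt1.
  have ie := inf_rel ncR Rpe ip.
  have oq : ~~ inner q.
    by case: He => -[l H]; have := H _ ie; ord.
  have := small ip; rewrite oq; ord.
exists (cutrel R p e); split.
- exact: (split_nc ncR rf Rpe lpe (fiK p) npe sm).
- have := split_realizes ncR rf (can_inj fK) Rpe lpe (fiK p) npe sm.
  by rewrite fe.
- by move=> a b [].
Qed.

Definition onerel (_ _ : int) := True.

Lemma onerel_nc : ncrel onerel.
Proof.
split=> // p _; split=> //; exists 1 => //.
by rewrite /inner dvdz1; lia.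
Qed.

Definition coxfun z :=
  if inner z then z - N else if inner (z + 1) then z + 2 else z + 1.

Lemma inner1 z : inner z -> ~~ inner (z + 1).
Proof.
move=> iz; rewrite /inner rpredDl // dvdz1; lia.
Qed.

Lemma coxfun_realizes : realizes onerel coxfun.
Proof.
move=> z; split=> //; left; have N1 := N_gt1.
have z1 : inner (z + 1) -> ~~ inner (z + 2).
  by move/inner1; have -> : z + 1 + 1 = z + 2 by lia.
rewrite /coxfun; case: (boolP (inner z)) => iz.
  split=> [|c _]; first by ord.
  apply/negP => l; have ic : inner c by ord.
  have [i cE] := innerP _ iz; have [j zE] := innerP _ ic.
  have : z - N < c < z by ord.
  rewrite cE zE => /andP[l1 l2]; have ji : j < i by nia.
  suff : i - 1 < j by lia.
  by nia.
case: (boolP (inner (z + 1))) => iz1.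
  have {}z1 := z1 iz1; split=> [|c _]; first by ord.
  have [-> |cz] := eqVneq c (z + 1); first by ord.
  by ord.
by split=> [|c _]; ord.
Qed.

Lemma eq_nc : ncrel eq.
Proof.
split=> //.
- by move=> q p r -> ->.
- by move=> p q k ->.
- by move=> a b c d ab bc cd ac; move: ab bc; rewrite ac; ord.
- by move=> p E; have := N_gt1; lia.
Qed.

Lemma eq_realizes f : realizes eq f -> f =1 id.
Proof. by move=> rf a; have [<-] := rf a. Qed.

Definition meetrel R1 R2 : int -> int -> Prop :=
  if pselect [/\ unbounded R1 0, unbounded R2 0 & forall x, R1 0 x -> R2 0 x ->
    inner x]
  then fun a b => (R1 a b /\ R2 a b) /\ (a = b \/ ~ (R1 a 0 /\ R2 a 0))
  else fun a b => R1 a b /\ R2 a b.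

Lemma meetrel_sub R1 R2 a b : meetrel R1 R2 a b -> R1 a b /\ R2 a b.
Proof. by rewrite /meetrel; case: pselect => // _ []. Qed.

Lemma meetrel_nc R1 R2 : ncrel R1 -> ncrel R2 -> ncrel (meetrel R1 R2).
Proof.
move=> nc1 nc2; have N1 := N_gt1; rewrite /meetrel; case: pselect => [[i1 i2 H]|H].
  have z1 p (k : int) : R1 p 0 -> R1 (p + k * N) 0.
    move=> p0; apply: (nc_trans nc1 _ p0); apply/(nc_sym nc1)/(inf_all nc1).
    exact: (inf_rel nc1 (nc_sym nc1 p0) i1).
  have z2 p (k : int) : R2 p 0 -> R2 (p + k * N) 0.
    move=> p0; apply: (nc_trans nc2 _ p0); apply/(nc_sym nc2)/(inf_all nc2).
    exact: (inf_rel nc2 (nc_sym nc2 p0) i2).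
  split.
  - by move=> p; split; [split; apply: nc_refl|left].
  - move=> p q [[pq1 pq2] E]; split; first by split; apply: nc_sym.
    case: E => [->|E]; [by left|right=> -[q01 q02]; apply: E].
    by split; [apply: nc_trans pq1 q01|apply: nc_trans pq2 q02].
  - move=> q p r [[pq1 pq2] E] [[qr1 qr2] E'].
    split; first by split; [apply: nc_trans pq1 qr1|apply: nc_trans pq2 qr2].
    case: E => [->//|E]; by right.
  - move=> p q k [[pq1 pq2] E]; split; first by split; apply: nc_shift.
    case: E => [->|E]; [by left|right=> -[q01 q02]; apply: E].
    have := z1 _ (- k) q01; have := z2 _ (- k) q02.
    by rewrite !mulNr !addrK.
  - move=> a b c d ab bc cd [[ac1 ac2] E] [[bd1 bd2] _].
    split; first by split; [apply: nc_cross ac1 bd1|apply: nc_cross ac2 bd2].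
    by case: E => [ac|E]; [move: ab bc; rewrite ac; ord|right].
  - move=> p [[p1 p2] [E|[]]]; first by lia.
    by split; [case: (nc_bal nc1 p1)|case: (nc_bal nc2 p2)].
split.
- by move=> p; split; apply: nc_refl.
- by move=> p q [pq1 pq2]; split; apply: nc_sym.
- by move=> q p r [pq1 pq2] [qr1 qr2]; split;
  [apply: nc_trans pq1 qr1|apply: nc_trans pq2 qr2].
- by move=> p q k [pq1 pq2]; split; apply: nc_shift.
- move=> a b c d ab bc cd [ac1 ac2] [bd1 bd2].
  by split; [apply: nc_cross ac1 bd1|apply: nc_cross ac2 bd2].
- move=> p [p1 p2]; have [p01 _] := nc_bal nc1 p1; have [p02 _] := nc_bal nc2 p2.
  split=> //; apply: contrapT => no; apply: (H); split.
  + exact: (inf_rel nc1 p01 p1).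
  + exact: (inf_rel nc2 p02 p2).
  + move=> x x1 x2; apply: contraT => ox; case: no; exists x => //.
    by split; [apply: nc_trans p01 x1|apply: nc_trans p02 x2].
Qed.

Lemma meetrel_max R1 R2 R : ncrel R1 -> ncrel R2 -> ncrel R ->
  (forall a b, R a b -> R1 a b) -> (forall a b, R a b -> R2 a b) ->
  forall a b, R a b -> meetrel R1 R2 a b.
Proof.
move=> nc1 nc2 ncR s1 s2 a b ab; rewrite /meetrel; case: pselect => [[i1 i2 H]|H].
  split; first by split; [apply: s1|apply: s2].
  have [->|neq] := eqVneq a b; [by left|right=> -[a01 a02]].
  have ia : inner a by apply: H; apply: nc_sym.
  have ib : inner b.
    by apply: H; [apply: nc_trans (s1 _ _ ab)|apply: nc_trans (s2 _ _ ab)] => //;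
      apply: nc_sym.
  have iRa : unbounded R a.
    by apply: contrapT => na; case/eqP: neq; apply: (inner_eq ncR).
  have [_ [x ox ax]] := nc_bal ncR iRa.
  case/negP: ox; apply: H; [apply: nc_trans (s1 _ _ ax)|apply: nc_trans (s2 _ _ ax)] => //;
      exact: nc_sym.
by split; [apply: s1|apply: s2].
Qed.

Definition twisted (x : int -> rat) := forall z, x (z + N) = 2 * x z.

Lemma twistedM x z (k : int) : twisted x -> x (z + k * N) = 2 ^ k * x z.
Proof.
move=> tx.
have up (j : nat) y : x (y + j%:Z * N) = 2 ^+ j * x y.
  elim: j => [|j IH]; first by rewrite mul0r addr0 expr0 mul1r.
  have -> : y + j.+1%:Z * N = y + j%:Z * N + N by nia.
  by rewrite tx IH exprS mulrA.
case: k => j; first exact: up.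
rewrite NegzE -exprnN; apply: (@mulfI _ (2 ^+ j.+1)); first by rewrite expf_neq0.
rewrite mulrA mulfV ?expf_neq0 // mul1r -up mulNr.
by congr x; lia.
Qed.

Lemma realizes_const R f x : ncrel R -> realizes R f -> twisted x ->
  (forall z, x (f z) = x z) -> forall a b, R a b -> x a = x b.
Proof.
move=> ncR rf tx xf; have N1 := N_gt1.
have out (j : nat) : forall a b, ~~ inner a -> ~~ inner b -> b - a = j%:Z ->
    R a b -> x a = x b.
  elim/ltn_ind: j => j IH a b oa ob E ab.
  have [->//|ne] := eqVneq a b; have lab : slt a b by ord.
  have [Raf [[laf H]|[laf H]]] := rf a; have := H _ ab; last by ord.
  move=> Hb; have [l1 [l2 l3]] : a < f a /\ f a <= b /\ ~~ inner (f a).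
    by split; [|split]; ord.
  rewrite -xf; apply: (IH (absz (b - f a))) => //; try by lia.
  exact: nc_trans (nc_sym ncR Raf) ab.
have inn (j : nat) : forall a b, inner a -> inner b -> a - b = j%:Z ->
    R a b -> x a = x b.
  elim/ltn_ind: j => j IH a b oa ob E ab.
  have [->//|ne] := eqVneq a b; have lab : slt a b by ord.
  have [Raf [[laf H]|[laf H]]] := rf a; have := H _ ab; last by ord.
  move=> Hb; have [l1 [l2 l3]] : f a < a /\ b <= f a /\ inner (f a).
    by split; [|split]; ord.
  rewrite -xf; apply: (IH (absz (f a - b))) => //; try by lia.
  exact: nc_trans (nc_sym ncR Raf) ab.
have same a b : inner a = inner b -> R a b -> x a = x b.
  case: (boolP (inner a)) => ia /esym ib ab.
    case: (leP a b) => l; last by apply: (inn (absz (a - b))) => //; lia.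
    by apply/esym/(inn (absz (a - b))) => //; [lia|apply: nc_sym].
  case: (leP a b) => l.
    by apply: (out (absz (a - b))) => //; [rewrite ib|lia].
  by apply/esym/(out (absz (a - b))) => //; [rewrite ib|lia|apply: nc_sym].
have infz a : unbounded R a -> x a = 0.
  move=> ia; have := same _ _ _ ia; rewrite innerD => /(_ erefl).
  by rewrite tx; lra.
have mix a b : ~~ inner a -> inner b -> R a b -> x a = x b.
  move=> oa ib ab; have [ia|nia_] := pselect (unbounded R a).
    by rewrite !infz //; apply: inf_rel ab ia.
  have [||m [om am] maxm] := @int_max (fun m => ~~ inner m /\ R a m) (a + N) a.
  - by split=> //; apply: nc_refl.
  - by move=> m [om am]; have := outer_bound ncR nia_ oa om am; lia.
  have mb := nc_trans ncR (nc_sym ncR am) ab.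
  have afm : R a (f m) by apply: nc_trans am _ => //; case: (rf m).
  have ifm : inner (f m).
    apply: contraT => ofm; have lm := maxm _ (conj ofm afm).
    by have [_ [[l _]|[l H]]] := rf m; [|have := H _ mb]; ord.
  rewrite (same a m) ?(negbTE oa) ?(negbTE om) // -xf.
  apply: same; first by rewrite ifm ib.
  exact: nc_trans (nc_sym ncR afm) ab.
move=> a b ab; case: (boolP (inner a)) => ia; case: (boolP (inner b)) => ib.
- by apply: same => //; rewrite ia ib.
- by apply/esym/mix => //; apply: nc_sym.
- exact: mix.
- by apply: same => //; rewrite (negbTE ia) (negbTE ib).
Qed.

Lemma block_indicator R a : ncrel R -> ~ unbounded R a ->
  exists x, [/\ twisted x, forall s t, R s t -> x s = x t, x a = 1
    & forall b, x b = 1 -> R a b].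
Proof.
move=> ncR na; have N1 := N_gt1.
have kuniq s (j k : int) : R (a + j * N) s -> R (a + k * N) s -> j = k.
  move=> js ks; apply: contrapT => jk; apply: na.
  apply: (@inf_ex _ ncR _ (k - j)); first by apply: contra_not_neq jk; lia.
  have := nc_shift ncR (- j) (nc_trans ncR js (nc_sym ncR ks)).
  by rewrite mulNr addrK mulrBl addrA.
pose P s (k : int) := R (a + k * N) s.
pose x s : rat :=
  if pselect (exists k, P s k) is left ex then 2 ^ (projT1 (cid ex)) else 0.
have xP s k : P s k -> x s = 2 ^ k.
  move=> Psk; rewrite /x; case: pselect => [ex|[]]; last by exists k.
  by case: cid => j /= Psj; rewrite (kuniq _ _ _ Psj Psk).
have xN s : ~ (exists k, P s k) -> x s = 0 by rewrite /x; case: pselect.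
exists x; split.
- move=> z; have [[k Pk]|no] := pselect (exists k, P z k).
    rewrite (xP _ _ Pk) (xP (z + N) (k + 1)); last first.
      by have := nc_shift ncR 1 Pk; rewrite /P mulrDl !mul1r addrA.
    by rewrite expfzDr // expr1z mulrC.
  rewrite !xN ?mulr0 // => -[k Pk]; apply: no; exists (k - 1).
  have := nc_shift ncR (-1) Pk; rewrite /P mulN1r addrK mulrBl mul1r addrA //.
- move=> s t st; have [[k Pk]|no] := pselect (exists k, P s k).
    by rewrite (xP _ _ Pk) (xP _ _ (nc_trans ncR Pk st)).
  rewrite !xN // => -[k Pk]; apply: no; exists k.
  exact: (nc_trans ncR Pk (nc_sym ncR st)).
- by rewrite (xP a 0) // /P mul0r addr0; apply: nc_refl.
- move=> b xb; have [[k Pk]|no] := pselect (exists k, P b k); last first.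
    by move: xb; rewrite xN // => /eqP; rewrite eq_sym oner_eq0.
  move: xb; rewrite (xP _ _ Pk) -(expr0z 2) => /(ieexprIz _ _) k0.
  by move: Pk; rewrite /P k0 ?mul0r ?addr0.
Qed.

Lemma fixed_rel R p q : ncrel R ->
  (forall x, twisted x -> (forall s t, R s t -> x s = x t) -> x p = x q) ->
  R p q.
Proof.
move=> ncR H.
have [ip|np] := pselect (unbounded R p); last first.
  by have [x [tx xR xp]] := block_indicator ncR np; apply; rewrite -H.
have [iq|nq] := pselect (unbounded R q); last first.
  have [x [tx xR xq Hx]] := block_indicator ncR nq; apply: nc_sym => //.
  by apply: Hx; rewrite H.
have [p0 _] := nc_bal ncR ip; have [q0 _] := nc_bal ncR iq.
exact: nc_trans p0 (nc_sym ncR q0).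
Qed.

End NC.

(** * The affine permutation action *)

Section Action.
Local Open Scope ring_scope.
Variable n : nat.
Hypothesis n_gt1 : (1 < n)%N.

Notation N := (n%:Z).
Notation W := (coxeter_group n).

Definition equivariant (w : int -> int) :=
  forall z k : int, w (z + k * N) = w z + k * N.

Lemma ndvd_small (z : int) : z != 0 -> - N < z < N -> ~~ (n %| z)%Z.
Proof.
move=> /eqP z0 zN; apply/dvdzP => -[k E].
have [k0|[k1|k1]] : k = 0 \/ 1 <= k \/ k <= -1 by lia.
- by apply: z0; rewrite E k0 mul0r.
- by have := mulN_ge1 n_gt1 k1; lia.
- by have := mulN_leN1 n_gt1 k1; lia.
Qed.

Lemma dvdzB_mul (z p k : int) : (n %| z + k * N - p)%Z = (n %| z - p)%Z.
Proof. by rewrite addrAC; apply: innerDM. Qed.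

Lemma swap_equiv p q : equivariant (swap n p q).
Proof.
move=> z k; rewrite /swap !dvdzB_mul; do 2![case: ifP => _; first by ring].
by [].
Qed.

Lemma swap_l p q : swap n p q p = q.
Proof. by rewrite /swap subrr dvdz0; ring. Qed.

Lemma swap_r p q : ~~ (n %| p - q)%Z -> swap n p q q = p.
Proof. by move=> pq; rewrite swapC // swap_l. Qed.

Lemma swap_id p q z : ~~ (n %| z - p)%Z -> ~~ (n %| z - q)%Z -> swap n p q z = z.
Proof. by rewrite /swap => /negbTE-> /negbTE->. Qed.

Lemma swapK p q : ~~ (n %| p - q)%Z -> involutive (swap n p q).
Proof.
move=> pq z; have [/dvdzP[k zE]|zp] := boolP (n %| z - p)%Z.
  have -> : z = p + k * N by lia.
  by rewrite !swap_equiv swap_l swap_r.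
have [/dvdzP[k zE]|zq] := boolP (n %| z - q)%Z.
  have -> : z = q + k * N by lia.
  by rewrite !swap_equiv swap_r // swap_l.
by rewrite !(swap_id zp zq).
Qed.

Lemma equiv_dvd (w : int -> int) z a : equivariant w -> injective w ->
  (n %| w z - w a)%Z = (n %| z - a)%Z.
Proof.
move=> we winj; apply/dvdzP/dvdzP => -[k E]; exists k.
  have : w z = w (a + k * N) by rewrite we; lia.
  by move/winj => ->; ring.
have -> : z = a + k * N by lia.
by rewrite we; ring.
Qed.

Lemma swap_conj w p q z : equivariant w -> injective w ->
  w (swap n p q z) = swap n (w p) (w q) (w z).
Proof.
move=> we winj.
have dv a := equiv_dvd z a we winj.
rewrite {2}/swap !dv; have [/dvdzP[k E]|zp] := boolP (n %| z - p)%Z.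
  have -> : z = p + k * N by lia.
  by rewrite swap_equiv swap_l !we; ring.
have [/dvdzP[k E]|zq] := boolP (n %| z - q)%Z; last by rewrite swap_id.
have zE : z = q + k * N by lia.
have pq : ~~ (n %| p - q)%Z.
  apply: contra zp => d; have -> : z - p = (z - q) - (p - q) by ring.
  by rewrite rpredB // E dvdz_mull.
by rewrite zE swap_equiv swap_r // !we; ring.
Qed.

Lemma swap_shift p q (k : int) : swap n (p + k * N) (q + k * N) =1 swap n p q.
Proof.
have dv z a : (n %| z - (a + k * N))%Z = (n %| z - a)%Z.
  by rewrite opprD addrA -mulNr; apply: innerDM.
by move=> z; rewrite /swap !dv; do 2![case: ifP => _; first by ring].
Qed.

Definition sgen (i : 'I_n) : int -> int := swap n i%:Z (i%:Z + 1).

Lemma sgen_ndvd (i : 'I_n) : ~~ (n %| (i%:Z - (i%:Z + 1)))%Z.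
Proof. by apply: ndvd_small; lia. Qed.

Lemma sgenK i : involutive (sgen i).
Proof. exact/swapK/sgen_ndvd. Qed.

Lemma sgen_equiv i : equivariant (sgen i). Proof. exact: swap_equiv. Qed.
Lemma sgen_inj i : injective (sgen i). Proof. exact: inv_inj (@sgenK i). Qed.

Lemma dvdz_ord (i j : 'I_n) : (n %| j%:Z - i%:Z)%Z = (i == j).
Proof.
apply/idP/eqP => [|->]; last by rewrite subrr dvdz0.
apply: contraTeq => ij; apply: ndvd_small; have := ltn_ord i; have := ltn_ord j.
  by move: ij; rewrite -(inj_eq val_inj) /=; lia.
by lia.
Qed.

Lemma ordS_val (i : 'I_n) : exists k : int, (ordS i)%:Z = i%:Z + 1 + k * N.
Proof.
rewrite /=; exists (- (i.+1 %/ n)%:Z).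
have : i.+1%:Z = (i.+1 %/ n * n + i.+1 %% n)%N%:Z by rewrite -divn_eq.
by move: (i.+1 %/ n)%N (i.+1 %% n)%N => q r; lia.
Qed.

Lemma dvdz_ordS (i j : 'I_n) : (n %| j%:Z - (i%:Z + 1))%Z = (j == ordS i).
Proof.
have [k E] := ordS_val i; rewrite eq_sym -dvdz_ord E.
have -> : j%:Z - (i%:Z + 1 + k * N) = j%:Z - (i%:Z + 1) + - k * N by ring.
exact/esym/innerDM.
Qed.

Lemma sgen_ordS i : sgen (ordS i) =1 swap n (i%:Z + 1) (i%:Z + 2).
Proof.
move=> z; rewrite /sgen; have [k ->] := ordS_val i.
have -> : i%:Z + 1 + k * N + 1 = i%:Z + 2 + k * N by ring.
exact: swap_shift.
Qed.

Lemma sgen_comm i j : i != j -> ~~ adjacent i j ->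
  forall z, sgen i (sgen j z) = sgen j (sgen i z).
Proof.
move=> ij; rewrite negb_or => /andP[ji ji'] z.
rewrite {2 3}/sgen (swap_conj _ _ _ (@sgen_equiv i) (@sgen_inj i)).
have -> : sgen i j%:Z = j%:Z by apply: swap_id; rewrite ?dvdz_ord // dvdz_ordS.
suff -> : sgen i (j%:Z + 1) = j%:Z + 1 by [].
apply: swap_id; last first.
  have -> : j%:Z + 1 - (i%:Z + 1) = j%:Z - i%:Z by ring.
  by rewrite dvdz_ord.
have -> : j%:Z + 1 - i%:Z = - (i%:Z - (j%:Z + 1)) by ring.
by rewrite rpredN dvdz_ordS.
Qed.

Lemma sgen_braid (i : 'I_n) : (2 < n)%N -> forall z,
  sgen i (sgen (ordS i) (sgen i z)) = sgen (ordS i) (sgen i (sgen (ordS i) z)).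
Proof.
move=> n2 z; set j := ordS i.
rewrite [sgen j (sgen i z)]sgen_ordS (swap_conj _ _ _ (@sgen_equiv i) (@sgen_inj i)) sgenK.
rewrite [sgen i (sgen j z)]/sgen (swap_conj _ _ _ (@sgen_equiv j) (@sgen_inj j)) sgenK.
have i1 : sgen i (i%:Z + 1) = i%:Z by apply/swap_r/sgen_ndvd.
have i2 : sgen i (i%:Z + 2) = i%:Z + 2 by apply: swap_id; apply: ndvd_small; lia.
have j0 : sgen j i%:Z = i%:Z by rewrite sgen_ordS; apply: swap_id;
  apply: ndvd_small; lia.
have j1 : sgen j (i%:Z + 1) = i%:Z + 2 by rewrite sgen_ordS swap_l.
by rewrite i1 i2 j0 j1.
Qed.

Definition actw (u : seq (bool * 'I_n)) : int -> int :=
  foldr (fun a f => sgen a.2 \o f) id u.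

Lemma actw_cat u v z : actw (u ++ v) z = actw u (actw v z).
Proof. by elim: u => //= a u ->. Qed.

Lemma actw_coxeter u v : coxeter_rel u v ->
  forall z, actw [seq (false, x) | x <- u] z = actw [seq (false, x) | x <- v] z.
Proof.
case=> i j z; rewrite /coxeter_mx.
have [->|ij] := eqVneq i j; first by rewrite /= sgenK.
case: (boolP (adjacent i j)) => adj; last by rewrite /= sgen_comm // !sgenK.
case: eqP => [//|n2]; rewrite /=.
have {}n2 : (2 < n)%N by lia.
case/orP: adj => /eqP E.
  by rewrite E -sgen_braid // !sgenK.
by rewrite E sgen_braid // !sgenK.
Qed.

Lemma actw_congr u v : word_congr (group_rel (@coxeter_rel n)) u v ->
  forall z, actw u z = actw v z.
Proof.
elim=> {u v} [p q u v r|//|u v _ IH z|u v w _ IH1 _ IH2 z]; last 2 first.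
- by rewrite IH.
- by rewrite IH1 IH2.
move=> z; rewrite !actw_cat; congr actw.
case: r => [u' v' /actw_coxeter -> //|b x /=]; exact: sgenK.
Qed.

Definition act (x : W) : int -> int := actw (repr x).

Lemma act_class u z : act (pm_class _ u) z = actw u z.
Proof.
by apply: actw_congr; apply/pm_classP; rewrite /pm_class reprK.
Qed.

Lemma actM x y z : act (x * y)%g z = act x (act y z).
Proof.
elim/pm_classW: x => u; elim/pm_classW: y => v.
by rewrite -pm_classM !act_class actw_cat.
Qed.

Lemma act1 z : act 1%g z = z. Proof. exact: act_class. Qed.

Lemma act_gen i z : act (cox_gen i) z = sgen i z.
Proof. exact: act_class. Qed.

Lemma actK x : cancel (act x) (act x^-1%g).
Proof. by move=> z; rewrite -actM mulVg act1. Qed.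
Lemma actKV x : cancel (act x^-1%g) (act x).
Proof. by move=> z; rewrite -actM mulgV act1. Qed.
Lemma act_inj x : injective (act x). Proof. exact: can_inj (actK x). Qed.
Lemma act_bij x : bijective (act x).
Proof. exact: Bijective (actK x) (actKV x). Qed.

Lemma cox_gen2 i : (cox_gen i * cox_gen i = 1 :> W)%g.
Proof. by rewrite -{1}cox_genV mulVg. Qed.

Lemma cox_ind (P : W -> Prop) : P 1%g -> (forall i x, P x -> P (cox_gen i * x)%g) ->
  forall x, P x.
Proof.
move=> P1 PM; elim/pm_classW; elim=> [//|[b i] u IH].
rewrite -cat1s pm_classM.
suff -> : pm_class (group_rel (@coxeter_rel n)) [:: (b, i)] = cox_gen i by apply: PM.
case: b; last by [].
apply: (@mulgI _ (cox_gen i)); rewrite cox_gen2 /cox_gen /pg_gen -pm_classM.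
by apply/pm_classP; exact: (word_congr_rel [::] [::] (group_rel_cancel _ false i)).
Qed.

Lemma act_equiv x : equivariant (act x).
Proof.
elim/cox_ind: x => [z k|i x IH z k]; first by rewrite !act1.
by rewrite !actM IH !act_gen sgen_equiv.
Qed.


Lemma int_ord (z : int) : exists (i : 'I_n) (k : int), z = i%:Z + k * N.
Proof.
have [k /andP[k1 k2]] := int_window n_gt1 z.
have lt : (absz (z - k * N)%R < n)%N by lia.
by exists (Ordinal lt), k => /=; lia.
Qed.

Lemma reflection_swap (r : W) : reflection r ->
  exists p q, ~~ (n %| p - q)%Z /\ act r =1 swap n p q.
Proof.
move=> [i [w ->]]; exists (act w^-1%g i%:Z), (act w^-1%g (i%:Z + 1)).
split; first by rewrite equiv_dvd ?sgen_ndvd //; [apply: act_equiv|apply: act_inj].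
move=> z; rewrite /conjg !actM act_gen /sgen.
by rewrite (swap_conj _ _ _ (@act_equiv _) (@act_inj _)) actK.
Qed.

Lemma reflection_conj (r w : W) : reflection r -> reflection (r ^ w)%g.
Proof. by move=> [i [x ->]]; exists i, (x * w)%g; rewrite conjgM. Qed.

Lemma swap_reflection p q : ~~ (n %| p - q)%Z ->
  exists r : W, reflection r /\ act r =1 swap n p q.
Proof.
have [m] := ubnP (absz (p - q)); elim: m p q => // m IH p q.
wlog lt_pq : p q / p < q => [wl|] le_m pq.
  have pq' : ~~ (n %| q - p)%Z by rewrite -opprB rpredN.
  have [l|l] : p < q \/ q < p.
      have : p != q by apply: contraNneq pq => ->; rewrite subrr dvdz0.
      by lia.
    exact: wl.
  have [|r [Hr rE]] := wl q p l _ pq'; first by rewrite distnC.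
  by exists r; split=> // z; rewrite rE swapC.
have [i [k pE]] := int_ord p.
have [qE|qp] := eqVneq q (p + 1).
  exists (cox_gen i); split; first by exists i, 1%g; rewrite conjg1.
  move=> z; rewrite act_gen qE pE /sgen.
  have -> : i%:Z + k * N + 1 = i%:Z + 1 + k * N by ring.
  by rewrite swap_shift.
have sp : sgen i p = p + 1 by rewrite pE sgen_equiv /sgen swap_l; ring.
have sq : sgen i q = q \/ sgen i q = q - 1.
  rewrite /sgen /swap; case: ifP => [d|_].
    case/negP: pq; rewrite -opprB rpredN pE.
    have -> : q - (i%:Z + k * N) = q - i%:Z + - k * N by ring.
    by have := innerDM n (q - i%:Z) (- k); rewrite /inner d.
  by case: ifP => _; [right; ring|left].
have npq : ~~ (n %| sgen i p - sgen i q)%Z.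
  by rewrite equiv_dvd //; [apply: sgen_equiv|apply: sgen_inj].
have [|r [Hr rE]] := IH _ _ _ npq; first by rewrite sp; case: sq => ->; lia.
exists (r ^ cox_gen i)%g; split; first exact: reflection_conj.
move=> z; rewrite /conjg cox_genV !actM !act_gen rE.
by rewrite (swap_conj _ _ _ (@sgen_equiv i) (@sgen_inj i)) !sgenK.
Qed.

Definition periodic (f : int -> int) := forall z k : int, f (z + k * N) = f z.

Definition winsum (f : int -> int) : int := \sum_(i < n) f i%:Z.

Lemma winsum_perm f w : periodic f -> equivariant w -> injective w ->
  winsum (f \o w) = winsum f.
Proof.
move=> pf we winj; rewrite /winsum.
pose s (i : 'I_n) := projT1 (cid (int_ord (w i%:Z))).
have sE (i : 'I_n) : exists k : int, w i%:Z = (s i)%:Z + k * N.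
  by rewrite /s; case: cid.
have s_inj : injective s.
  move=> i j; have [k Ek] := sE i; have [l El] := sE j => ss.
  apply/eqP; rewrite -dvdz_ord -(equiv_dvd _ _ we winj) Ek El ss.
  have -> : (s j)%:Z + l * N - ((s j)%:Z + k * N) = (l - k) * N by ring.
  exact: dvdz_mull.
rewrite [RHS](reindex_inj s_inj); apply: eq_bigr => i _ /=.
by have [k ->] := sE i; rewrite pf.
Qed.

Lemma winsum_two f (i : 'I_n) : periodic f ->
  (forall z, ~~ (n %| z - i%:Z)%Z -> ~~ (n %| z - (i%:Z + 1))%Z -> f z = 0) ->
  winsum f = f i%:Z + f (i%:Z + 1).
Proof.
move=> pf f0; rewrite /winsum (bigD1 i) //= (bigD1 (ordS i)) /=.
  have [k ->] := ordS_val i; rewrite pf big1 ?addr0 // => j /andP[ji jS].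
  by apply: f0; rewrite ?dvdz_ord ?dvdz_ordS // eq_sym.
by rewrite eq_sym -dvdz_ordS sgen_ndvd.
Qed.

Lemma winsum_act x : winsum (fun z => act x z - z) = 0.
Proof.
elim/cox_ind: x => [|i x IH].
  by apply: big1 => i _; rewrite act1 subrr.
pose f z := sgen i z - z.
have pf : periodic f by move=> z k; rewrite /f sgen_equiv; ring.
have f0 : winsum f = 0.
  rewrite (winsum_two pf (i := i));
    first by rewrite /f /sgen swap_l swap_r ?sgen_ndvd //; ring.
  by move=> z z1 z2; rewrite /f /sgen swap_id // subrr.
rewrite -[RHS]addr0 -{1}f0 -(winsum_perm pf (act_equiv x) (@act_inj x)) -IH.
rewrite /winsum -big_split; apply: eq_bigr => j _ /=.
by rewrite actM act_gen /f; ring.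
Qed.

Definition disp2 (w : int -> int) : int := winsum (fun z => (w z - z) ^+ 2).

Lemma disp2_ge0 w : 0 <= disp2 w.
Proof. by apply: sumr_ge0 => i _; apply: sqr_ge0. Qed.

Lemma disp2_gen w i : equivariant w ->
  disp2 (w \o sgen i) = disp2 w + 2 * (w (i%:Z + 1) - w i%:Z).
Proof.
move=> we; pose f z := (w z - z) ^+ 2.
pose g z := 2 * (w (sgen i z) - sgen i z) * (sgen i z - z) + (sgen i z - z) ^+ 2.
have pf : periodic f by move=> z k; rewrite /f we; ring.
have pg : periodic g by move=> z k; rewrite /g sgen_equiv we; ring.
have gE : winsum g = 2 * (w (i%:Z + 1) - w i%:Z).
  rewrite (winsum_two pg (i := i));
    first by rewrite /g /sgen swap_l swap_r ?sgen_ndvd //; ring.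
  by move=> z z1 z2; rewrite /g /sgen swap_id // !subrr; ring.
rewrite -gE /disp2 -/f -(winsum_perm pf (@sgen_equiv i) (@sgen_inj i)).
rewrite /winsum -big_split; apply: eq_bigr => j _ /=; rewrite /f /g; ring.
Qed.

Lemma no_descent_id x : (forall i : 'I_n, act x i%:Z <= act x (i%:Z + 1)) ->
  act x =1 id.
Proof.
move=> H.
have step (z : int) : act x z < act x (z + 1).
  have [i [k ->]] := int_ord z.
  have -> : i%:Z + k * N + 1 = i%:Z + 1 + k * N by ring.
  rewrite !act_equiv; have := H i; rewrite le_eqVlt => /orP[/eqP/act_inj|]; lia.
have mono (j : nat) : forall z : int, act x z + j%:Z <= act x (z + j%:Z).
  elim: j => [|j IH] z; first by rewrite !addr0.
  have := IH z; have := step (z + j%:Z).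
  have -> : z + j.+1%:Z = z + j%:Z + 1 by lia.
  lia.
have next (z : int) : act x (z + 1) = act x z + 1.
  pose y := act x^-1%g (act x z + 1);
    have yE : act x y = act x z + 1 by rewrite actKV.
  have [l|l] := leP y z.
    have := mono (absz (z - y)%R) y; have -> : y + (absz (z - y)%R)%:Z = z by lia.
    lia.
  have [->|ne] := eqVneq (z + 1) y; first by rewrite yE.
  have := mono (absz (y - (z + 1))%R) (z + 1).
  have -> : z + 1 + (absz (y - (z + 1))%R)%:Z = y by lia.
  by have := step z; lia.
have lin (j : nat) : act x j%:Z = act x 0 + j%:Z.
  elim: j => [|j IH]; first by rewrite addr0.
  have -> : j.+1%:Z = j%:Z + 1 by lia.
  by rewrite next IH; lia.
have x0 : act x 0 = 0.
  have := winsum_act x; rewrite /winsum.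
  under eq_bigr do rewrite lin addrK.
  rewrite sumr_const card_ord => /eqP; rewrite mulrn_eq0 => /orP[/eqP|/eqP //]; lia.
move=> z; have [i [k ->]] := int_ord z.
by rewrite act_equiv lin x0 add0r.
Qed.

Lemma cox_rel1 (i j : 'I_n) :
  pm_class (group_rel (@coxeter_rel n))
    [seq (false, x) | x <- flatten (nseq (coxeter_mx i j) [:: i; j])] = 1%g.
Proof.
apply/pm_classP; have := CoxeterRel i j => /group_rel_def.
by move=> /(word_congr_rel [::] [::]); rewrite !cats0.
Qed.

Lemma cox_classE u :
  pm_class (group_rel (@coxeter_rel n)) [seq (false, x) | x <- u] =
  (\prod_(i <- u) cox_gen i)%g.
Proof.
elim: u => [|i u IH]; first by rewrite big_nil.
by rewrite big_cons -IH /= -cat1s pm_classM.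
Qed.

Lemma cox_comm (i j : 'I_n) : i != j -> ~~ adjacent i j ->
  (cox_gen i * cox_gen j = cox_gen j * cox_gen i :> W)%g.
Proof.
move=> ij adj; have := cox_rel1 i j;
  rewrite cox_classE /coxeter_mx (negbTE ij) (negbTE adj).
rewrite /= !big_cons big_nil mulg1 => E.
apply: (@mulgI _ (cox_gen i)); rewrite !mulgA cox_gen2 mul1g.
apply: (@mulIg _ (cox_gen j)); rewrite cox_gen2 -{}E !mulgA //.
Qed.

Lemma cox_braid (i : 'I_n) : (2 < n)%N ->
  (cox_gen i * (cox_gen (ordS i) * cox_gen i) =
   cox_gen (ordS i) * (cox_gen i * cox_gen (ordS i)) :> W)%g.
Proof.
move=> n2; set j := ordS i; have := cox_rel1 i j; rewrite cox_classE /coxeter_mx.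
have -> : i == j = false by apply/negbTE; rewrite -dvdz_ordS sgen_ndvd.
have -> : adjacent i j by rewrite /adjacent eqxx.
have -> : (n == 2) = false by lia.
rewrite /= !big_cons big_nil mulg1 => E.
have K a (x : W) : (cox_gen a * (cox_gen a * x) = x)%g.
  by rewrite mulgA cox_gen2 mul1g.
apply: (@mulIg _ (cox_gen j * (cox_gen i * cox_gen j))%g).
by rewrite -!mulgA E !K cox_gen2.
Qed.

(* canon x g: g is obtained by sorting the affine permutation act x; as this does
   not depend on the order in which descents are removed, act is faithful. *)
Inductive canon : W -> W -> Prop :=
| canon_id x : act x =1 id -> canon x 1%g
| canon_desc x (i : 'I_n) g : act x (i%:Z + 1) < act x i%:Z ->
    canon (x * cox_gen i)%g g -> canon x (g * cox_gen i)%g.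

Lemma canon_ext x y g : canon x g -> act x =1 act y -> canon y g.
Proof.
move=> H; elim: H y => {x g} [x xid y xy|x i g d _ IH y xy].
  by apply: canon_id => z; rewrite -xy.
apply: canon_desc; first by rewrite -!xy.
by apply: IH => z; rewrite !actM xy.
Qed.

Lemma disp2_desc x (i : 'I_n) : act x (i%:Z + 1) < act x i%:Z ->
  disp2 (act (x * cox_gen i)%g) < disp2 (act x).
Proof.
move=> d; have -> : act (x * cox_gen i)%g = act x \o sgen i.
  by apply: funext => z; rewrite actM act_gen.
by rewrite disp2_gen; [lia|apply: act_equiv].
Qed.

Lemma canon_ex x : exists g, canon x g.
Proof.
have [m] := ubnP (absz (disp2 (act x))); elim: m x => // m IH x le_m.
have [[i d]|nd] := pselect (exists i : 'I_n, act x (i%:Z + 1) < act x i%:Z).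
  have [|g Hg] := IH (x * cox_gen i)%g; last by exists (g * cox_gen i)%g;
    apply: canon_desc.
  by have := disp2_desc d; have := disp2_ge0 (act (x * cox_gen i)%g); lia.
exists 1%g; apply: canon_id; apply: no_descent_id => i.
by rewrite leNgt; apply/negP => d; apply: nd; exists i.
Qed.

Lemma act_mul_gen x i z : act (x * cox_gen i)%g z = act x (sgen i z).
Proof. by rewrite actM act_gen. Qed.

Lemma canon_uniq x g g' : canon x g -> canon x g' -> g = g'.
Proof.
have [m] := ubnP (absz (disp2 (act x))); elim: m x g g' => // m IH x g g' le_m H H'.
have uniq_desc (i : 'I_n) h h' : act x (i%:Z + 1) < act x i%:Z ->
    canon (x * cox_gen i)%g h -> canon (x * cox_gen i)%g h' -> h = h'.
  move=> d; apply: IH.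
  by have := disp2_desc d; have := disp2_ge0 (act (x * cox_gen i)%g); lia.
have braid (i : 'I_n) h h' : (2 < n)%N -> act x (i%:Z + 1) < act x i%:Z ->
   act x ((ordS i)%:Z + 1) < act x (ordS i)%:Z ->
   canon (x * cox_gen i)%g h -> canon (x * cox_gen (ordS i))%g h' ->
   (h * cox_gen i = h' * cox_gen (ordS i))%g.
  move=> n2 d; set j := ordS i => d' Hh Hh'.
  have [k jE] := ordS_val i; rewrite -/j in jE.
  have d2 : act x (i%:Z + 2) < act x (i%:Z + 1).
    move: d'; rewrite jE; have -> : i%:Z + 1 + k * N + 1 = i%:Z + 2 + k * N by ring.
    by rewrite !act_equiv; lia.
  have i0 : sgen i i%:Z = i%:Z + 1 by apply: swap_l.
  have i1 : sgen i (i%:Z + 1) = i%:Z by apply/swap_r/sgen_ndvd.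
  have i2 : sgen i (i%:Z + 2) = i%:Z + 2 by apply: swap_id; apply: ndvd_small; lia.
  have j0 : sgen j i%:Z = i%:Z by rewrite sgen_ordS; apply: swap_id;
    apply: ndvd_small; lia.
  have j1 : sgen j (i%:Z + 1) = i%:Z + 2 by rewrite sgen_ordS swap_l.
  have j2 : sgen j (i%:Z + 2) = i%:Z + 1.
    by rewrite sgen_ordS; apply/swap_r/ndvd_small; lia.
  have jj1 : j%:Z + 1 = i%:Z + 2 + k * N by rewrite jE; ring.
  have [h0 H0] := canon_ex (x * cox_gen i * cox_gen j * cox_gen i)%g.
  have E1 : h = (h0 * cox_gen i * cox_gen j)%g.
    apply: (uniq_desc i) => //; apply: canon_desc.
      by rewrite jj1 jE !act_mul_gen !sgen_equiv !act_equiv i1 i2; lia.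
    by apply: canon_desc => //; rewrite !act_mul_gen j0 j1 i0 i2; lia.
  have H0' : canon (x * cox_gen j * cox_gen i * cox_gen j)%g h0.
    by apply: canon_ext H0 _ => z; rewrite !act_mul_gen sgen_braid.
  have E2 : h' = (h0 * cox_gen j * cox_gen i)%g.
    apply: (uniq_desc j) => //; apply: canon_desc.
      by rewrite !act_mul_gen j0 j1; lia.
    apply: canon_desc => //.
    by rewrite jj1 jE !act_mul_gen !sgen_equiv !act_equiv i1 i2 j0 j2; lia.
  by rewrite E1 E2 -!mulgA cox_braid.
have descP (i : 'I_n) : act x (i%:Z + 1) < act x i%:Z -> ~ act x =1 id.
  by move=> d xid; move: d; rewrite !xid; lia.
case: H H' le_m uniq_desc braid descP => {x g} [x xid|x i g d Hg] H' le_m uniq_desc braid descP.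
  by case: H' descP xid => // y j h d _ descP /(descP _ d).
case: H' d Hg le_m uniq_desc braid descP => {x g'} [x xid|x j g' d' Hg'] d Hg le_m uniq_desc braid descP.
  by case: (descP _ d).
have [ij|ij] := eqVneq i j; first by subst j; rewrite (uniq_desc _ _ _ d Hg Hg').
case: (boolP (adjacent i j)) => adj.
  have n2 : (2 < n)%N.
    have n2 (a : 'I_n) : act x (a%:Z + 1) < act x a%:Z ->
        act x ((ordS a)%:Z + 1) < act x (ordS a)%:Z -> 2 != n.
      have [k ->] := ordS_val a.
      have -> : a%:Z + 1 + k * N + 1 = a%:Z + 2 + k * N by ring.
      rewrite !act_equiv => d1 d2; apply/eqP => n2.
      have := @act_equiv x a%:Z 1; rewrite mul1r.
      have -> : a%:Z + N = a%:Z + 2 by lia.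
      lia.
    rewrite ltn_neqAle n_gt1 andbT.
    by case/orP: adj => /eqP E; [apply: (n2 i)|apply: (n2 j)]; rewrite -?E.
  by case/orP: adj => /eqP E; subst; [|symmetry]; apply: braid.
have [h Hh] := canon_ex (x * cox_gen i * cox_gen j)%g.
have s0 (a b : 'I_n) : a != b -> ~~ adjacent a b ->
    sgen a b%:Z = b%:Z /\ sgen a (b%:Z + 1) = b%:Z + 1.
  move=> ab; rewrite negb_or => /andP[ba ba'].
  split; apply: swap_id; rewrite ?dvdz_ord ?dvdz_ordS //.
    have -> : b%:Z + 1 - a%:Z = - (a%:Z - (b%:Z + 1)) by ring.
    by rewrite rpredN dvdz_ordS.
  have -> : b%:Z + 1 - (a%:Z + 1) = b%:Z - a%:Z by ring.
  by rewrite dvdz_ord.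
have [sij sij'] := s0 _ _ ij adj.
have [sji sji'] : sgen j i%:Z = i%:Z /\ sgen j (i%:Z + 1) = i%:Z + 1.
  by apply: s0; rewrite 1?eq_sym // /adjacent orbC.
have Hh' : canon (x * cox_gen j * cox_gen i)%g h.
  by rewrite -mulgA -cox_comm // mulgA.
have -> : g = (h * cox_gen j)%g.
  apply: (uniq_desc i) => //; apply: canon_desc => //.
  by rewrite !act_mul_gen sij sij'.
have -> : g' = (h * cox_gen i)%g.
  apply: (uniq_desc j) => //; apply: canon_desc => //.
  by rewrite !act_mul_gen sji sji'.
by rewrite -!mulgA (cox_comm ij adj).
Qed.

Lemma cox_ind_r (P : W -> Prop) : P 1%g -> (forall i x, P x ->
  P (x * cox_gen i)%g) ->
  forall x, P x.
Proof.
move=> P1 PM x; rewrite -[x]invgK; elim/cox_ind: (x^-1)%g => [|i y Py].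
  by rewrite invg1.
by rewrite invgM cox_genV; apply: PM.
Qed.

Lemma canon_self x : canon x x.
Proof.
elim/cox_ind_r: x => [|i x IH]; first by apply: canon_id; apply: act1.
have [d|nd] := boolP (act x i%:Z < act x (i%:Z + 1)).
  apply: canon_desc; last by rewrite -mulgA cox_gen2 mulg1.
  by rewrite !act_mul_gen /sgen swap_l swap_r // sgen_ndvd.
have d : act x (i%:Z + 1) < act x i%:Z.
  move: nd; rewrite -leNgt le_eqVlt => /orP[/eqP/act_inj|//]; lia.
have [g Hg] := canon_ex (x * cox_gen i)%g.
have := canon_uniq IH (canon_desc d Hg) => {2}->.
by rewrite -mulgA cox_gen2 mulg1.
Qed.

Lemma act_faithful x y : act x =1 act y -> x = y.
Proof.
move=> xy; apply: (@canon_uniq y); last exact: canon_self.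
exact: canon_ext (canon_self x) xy.
Qed.

End Action.

(** * Reflection length and rank *)

Section Length.
Variable n : nat.
Notation W := (coxeter_group n).
Local Open Scope group_scope.
Implicit Types x y r : W.

Lemma l_R_le x k : prod_of_reflections x k -> (l_R x <= k)%N.
Proof. by move=> H; rewrite /l_R; case: ex_minnP => m _; apply; apply/asboolP. Qed.

Lemma l_R_prod x : prod_of_reflections x (l_R x).
Proof. by rewrite /l_R; case: ex_minnP => m /asboolP. Qed.

Lemma prod_of_reflectionsM x y k l : prod_of_reflections x k ->
  prod_of_reflections y l -> prod_of_reflections (x * y) (k + l).
Proof.
move=> [rs [<- rsP <-]] [ts [<- tsP <-]]; exists (rs ++ ts); split.
- by rewrite size_cat.
- by move=> r; rewrite mem_cat => /orP[/rsP|/tsP].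
- by rewrite big_cat.
Qed.

Lemma prod_of_reflections1 : prod_of_reflections (1 : W) 0.
Proof. by exists [::]; rewrite big_nil. Qed.

Lemma prod_of_reflections_refl r : reflection r -> prod_of_reflections r 1.
Proof.
move=> Hr; exists [:: r]; rewrite big_seq1; split=> // s.
by rewrite inE => /eqP ->.
Qed.

Lemma prod_of_reflections_conj x y k : prod_of_reflections x k ->
  prod_of_reflections (x ^ y) k.
Proof.
move=> [rs [<- rsP <-]]; exists [seq r ^ y | r <- rs]; split.
- by rewrite size_map.
- by move=> _ /mapP[r /rsP Hr ->]; apply: reflection_conj.
- by rewrite big_map conjg_prod.
Qed.

Lemma l_RM x y : (l_R (x * y)%g <= l_R x + l_R y)%N.
Proof. by apply: l_R_le; apply: prod_of_reflectionsM; apply: l_R_prod. Qed.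

Lemma l_RJ x y : l_R (x ^ y) = l_R x.
Proof.
apply/eqP; rewrite eqn_leq; apply/andP; split.
  by apply: l_R_le; apply/prod_of_reflections_conj/l_R_prod.
rewrite -{1}[x](conjgK y); apply: l_R_le.
exact/prod_of_reflections_conj/l_R_prod.
Qed.

Lemma l_R1 : l_R (1 : W) = 0%N.
Proof. by apply/eqP; rewrite -leqn0; apply/l_R_le/prod_of_reflections1. Qed.

Lemma l_R_eq0 x : l_R x = 0%N -> x = 1.
Proof.
move=> x0; have [rs [rs0 _ <-]] := l_R_prod x.
by move: rs0; rewrite x0 => /size0nil ->; rewrite big_nil.
Qed.

End Length.

Section Rank.
Local Open Scope ring_scope.
Variable n : nat.
Hypothesis n_gt1 : (1 < n)%N.
Notation N := (n%:Z).
Notation W := (coxeter_group n).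

Implicit Types x y r : W.

Fixpoint swaps (a : int) (m : nat) : int -> int :=
  if m is m'.+1 then swap n a (a + 1) \o swaps (a + 1) m' else id.

Lemma swaps_equiv a m : equivariant n (swaps a m).
Proof. by elim: m a => [//|m IH] a z k /=; rewrite IH swap_equiv. Qed.

Lemma swapsE (a : int) (m : nat) : (m < n)%N -> forall z : int, a <= z < a + N ->
  swaps a m z = if z < a + m%:Z then z + 1 else if z == a + m%:Z then a else z.
Proof.
elim: m a => [|m IH] a mn z zN.
  by rewrite /= addr0; case: ifP => [|_]; [lia|case: ifP => // /eqP ->].
have mn' : (m < n)%N by lia.
have nd1 : ~~ (n %| a - (a + 1))%Z by apply: ndvd_small => //; lia.
have [->|za] := eqVneq z a.
  have sa : swaps (a + 1) m a = a.
    have := IH (a + 1) mn' (a + N); rewrite !ifN; [|lia|lia].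
    have -> : a + N = a + 1 * N by ring.
    by rewrite swaps_equiv => /(_ _)/addIr; apply; lia.
  by rewrite /= sa swap_l ifT; [|lia].
rewrite /= IH //; last by lia.
case: ifP => z1.
  rewrite ifT; last by lia.
  by apply: swap_id; apply: ndvd_small => //; lia.
case: ifP => z2.
  by rewrite ifN; [rewrite ifT; [apply: swap_r|lia]|lia].
rewrite !ifN; [|lia|lia].
by apply: swap_id; apply: ndvd_small => //; lia.
Qed.

Lemma act_prod (rs : seq 'I_n) a : map val rs = iota a (size rs) ->
  act (\prod_(i <- rs) cox_gen i)%g =1 swaps a%:Z (size rs).
Proof.
elim: rs a => [|i rs IH] a /=; first by rewrite big_nil => _; apply: act1.
move=> [ia E] z; rewrite big_cons (actM n_gt1) (act_gen n_gt1).
have -> := IH _ E z; rewrite /sgen ia /=.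
by have -> : a.+1%:Z = a%:Z + 1 by lia.
Qed.

Lemma act_cox_c : act (cox_c n) =1 coxfun n.
Proof.
have E : act (cox_c n) =1 swaps 0 n.
  have sz : size (index_enum 'I_n) = n.
    by rewrite [index_enum _]unlock -enumT size_enum_ord.
  have hs : [seq val i | i <- index_enum 'I_n] = iota 0 n.
    by rewrite [index_enum _]unlock -enumT val_enum_ord.
  by have := @act_prod (index_enum 'I_n) 0; rewrite sz => /(_ hs).
have n0 : n = n.-1.+1 by lia.
have main z : 1 <= z < 1 + N -> act (cox_c n) z = coxfun n z.
  move=> zN; rewrite E {1}n0 /= swapsE; [|lia|lia].
  have nd1 : ~~ (n %| 0 - (0 + 1))%Z by apply: ndvd_small => //; lia.
  rewrite /coxfun; have [->|zn] := eqVneq z N.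
    have -> : inner n N by rewrite /inner dvdzz.
    rewrite ifN; last by lia.
    by rewrite ifT; [rewrite swap_r ?subrr|lia].
  have -> : inner n z = false.
    by apply/negbTE; have := @ndvd_small n n_gt1 z; rewrite /inner; apply; lia.
  rewrite ifT; last by lia.
  have [zn1|zn1] := eqVneq (z + 1) N.
    have -> : inner n (z + 1) by rewrite zn1 /inner dvdzz.
    have -> : z + 1 = 0 + 1 * N by rewrite zn1; ring.
    by rewrite swap_equiv swap_l; lia.
  have -> : inner n (z + 1) = false.
    by apply/negbTE; have := @ndvd_small n n_gt1 (z + 1); rewrite /inner; apply; lia.
  by apply: swap_id; apply: ndvd_small => //; lia.
move=> z; have [k kz] := int_window n_gt1 (z - 1).
have -> : z = z - k * N + k * N by ring.
have ceq : coxfun n (z - k * N + k * N) = coxfun n (z - k * N) + k * N.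
  rewrite /coxfun; have -> : z - k * N + k * N + 1 = z - k * N + 1 + k * N by ring.
  by rewrite !innerDM; do 2![case: ifP => _; first by ring]; ring.
rewrite ceq (act_equiv n_gt1); congr (_ + _); apply: main; lia.
Qed.

Definition ordz (z : int) : 'I_n := projT1 (cid (int_ord n_gt1 z)).
Definition htz (z : int) : int := projT1 (cid (projT2 (cid (int_ord n_gt1 z)))).

Lemma ordzE z : z = (ordz z)%:Z + htz z * N.
Proof. exact: (projT2 (cid (projT2 (cid (int_ord n_gt1 z))))). Qed.

Lemma ord_uniq (i j : 'I_n) (k l : int) : i%:Z + k * N = j%:Z + l * N ->
  i = j /\ k = l.
Proof.
move=> E; have ij : i = j.
  apply/eqP; rewrite -(dvdz_ord n_gt1); have -> : j%:Z - i%:Z = (k - l) * N by lia.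
  exact: dvdz_mull.
split=> //; move: E; rewrite ij => /addrI /mulIf; apply; lia.
Qed.

Lemma ordz_ord (i : 'I_n) (k : int) :
  ordz (i%:Z + k * N) = i /\ htz (i%:Z + k * N) = k.
Proof. by have /esym/ord_uniq[] := ordzE (i%:Z + k * N). Qed.

(* tw v is the twisted function with values v on 0, ..., n - 1. *)
Definition twcol (z : int) : 'cV[rat]_n :=
  \col_i (if ordz z == i then 2 ^ htz z else 0).

Definition tw (v : 'rV[rat]_n) (z : int) : rat := (v *m twcol z) 0 0.

Lemma twE v (i : 'I_n) (k : int) : tw v (i%:Z + k * N) = 2 ^ k * v 0 i.
Proof.
rewrite /tw mxE (bigD1 i) //= big1 ?addr0 => [|j ji]; rewrite mxE.
  by have [-> ->] := ordz_ord i k; rewrite eqxx mulrC.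
by have [-> _] := ordz_ord i k; rewrite eq_sym (negbTE ji) mulr0.
Qed.

Lemma tw_ord v (i : 'I_n) : tw v i%:Z = v 0 i.
Proof. by have := twE v i 0; rewrite mul0r addr0 mul1r. Qed.

Lemma tw_twisted v : twisted n (tw v).
Proof.
move=> z; rewrite (ordzE z); set i := ordz z; set k := htz z.
have -> : i%:Z + k * N + N = i%:Z + (k + 1) * N by ring.
by rewrite !twE expfzDr // expr1z; ring.
Qed.

Lemma twisted_tw (x : int -> rat) : twisted n x -> exists v, tw v =1 x.
Proof.
move=> tx; exists (\row_i x i%:Z) => z; rewrite (ordzE z) twE mxE.
by rewrite (twistedM _ _ _ tx).
Qed.

Definition twmx (w : int -> int) : 'M[rat]_n := \matrix_(i, j) twcol (w j%:Z) i 0.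

Lemma mul_twmx v w j : (v *m twmx w) 0 j = tw v (w j%:Z).
Proof. by rewrite /tw !mxE; apply: eq_bigr => i _; rewrite !mxE. Qed.

Lemma tw_twmx v w z : equivariant n w -> tw (v *m twmx w) z = tw v (w z).
Proof.
move=> we; rewrite (ordzE z) twE mul_twmx we.
by rewrite (twistedM n_gt1 _ _ (tw_twisted v)).
Qed.

Lemma eq_mulmx (m : nat) (A B : 'M[rat]_(n, m)) :
  (forall v : 'rV_n, v *m A = v *m B) -> A = B.
Proof. by move=> H; apply/row_matrixP => i; rewrite !rowE. Qed.

Lemma twmx_comp w w' : equivariant n w -> twmx (w \o w') = twmx w *m twmx w'.
Proof.
move=> we; apply: eq_mulmx => v; apply/rowP => j.
by rewrite mulmxA !mul_twmx tw_twmx.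
Qed.

Definition amx (x : W) : 'M[rat]_n := twmx (act x) - 1%:M.
Definition frank (x : W) : nat := \rank (amx x).

Lemma amxP v x : reflect (forall z, tw v (act x z) = tw v z) (v *m amx x == 0).
Proof.
rewrite /amx mulmxBr mulmx1 subr_eq0; apply: (iffP eqP) => [E z|E].
  by rewrite -tw_twmx ?E //; apply: act_equiv.
by apply/rowP => j; rewrite mul_twmx E tw_ord.
Qed.

Lemma twmxM x y : twmx (act (x * y)%g) = twmx (act x) *m twmx (act y).
Proof.
rewrite -twmx_comp; last exact: act_equiv.
by congr twmx; apply: funext => z; rewrite actM.
Qed.

Lemma frankM x y : (frank (x * y)%g <= frank x + frank y)%N.
Proof.
have E : amx (x * y)%g = amx x *m twmx (act y) + amx y.
  by rewrite /amx twmxM mulmxBl mul1mx addrA subrK.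
rewrite /frank E; apply: leq_trans (mxrank_add _ _) _.
by rewrite leq_add2r mxrankM_maxl.
Qed.

Lemma frank_fix x y (v : 'rV_n) : frank (x * y)%g = (frank x + frank y)%N ->
  v *m amx (x * y)%g = 0 -> v *m amx x = 0.
Proof.
move=> E; set K := kermx (amx x); set L := kermx (amx y);
  set M := kermx (amx (x * y)%g).
have KLM : (K :&: L <= M)%MS.
  apply/rV_subP => u; rewrite sub_capmx => /andP[/sub_kermxP/eqP/amxP ux /sub_kermxP/eqP/amxP uy].
  by apply/sub_kermxP/eqP/amxP => z; rewrite (actM n_gt1) ux uy.
have rk : (\rank M <= \rank (K :&: L)%MS)%N.
  have := mxrank_sum_cap K L; rewrite !mxrank_ker -/(frank x) -/(frank y) -/(frank (x * y)%g) E.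
  have := rank_leq_row (K + L)%MS; have := rank_leq_row (amx x);
    have := rank_leq_row (amx y).
  rewrite -/(frank x) -/(frank y); lia.
have := mxrank_leqif_sup KLM => /geq_leqif; rewrite rk => /esym MKL vM.
have : (v <= K :&: L)%MS by apply: submx_trans MKL; apply/sub_kermxP.
by rewrite sub_capmx => /andP[/sub_kermxP].
Qed.

Lemma frank_lt x y : (forall v : 'rV_n, v *m amx x = 0 -> v *m amx y = 0) ->
  (exists v : 'rV_n, v *m amx y = 0 /\ v *m amx x <> 0) -> (frank y < frank x)%N.
Proof.
move=> sub [v [vy vx]].
have lt : (kermx (amx x) < kermx (amx y))%MS.
  rewrite ltmxE; apply/andP; split.
    by apply/rV_subP => u /sub_kermxP/sub uy; apply/sub_kermxP.
  apply/negP => le; apply: vx; apply/sub_kermxP; apply: submx_trans le.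
  exact/sub_kermxP.
have := rank_ltmx lt; rewrite !mxrank_ker -/(frank x) -/(frank y).
have := rank_leq_row (amx x); rewrite -/(frank x); lia.
Qed.

Lemma tw_swap v p q z : tw v p = tw v q -> tw v (swap n p q z) = tw v z.
Proof.
move=> pq; rewrite /swap; have tM := fun z k => twistedM n_gt1 z k (tw_twisted v).
case: dvdzP => [[k zE]|_].
  have -> : z - p + q = q + k * N by rewrite zE; ring.
  have -> : z = p + k * N by rewrite -zE; ring.
  by rewrite !tM pq.
case: dvdzP => [[k zE]|//].
have -> : z - q + p = p + k * N by rewrite zE; ring.
have -> : z = q + k * N by rewrite -zE; ring.
by rewrite !tM pq.
Qed.

Lemma frank_refl r : reflection r -> (frank r <= 1)%N.
Proof.
move=> /(reflection_swap n_gt1)[p [q [pq rE]]].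
pose c := twcol p - twcol q.
have le : (kermx c <= kermx (amx r))%MS.
  apply/rV_subP => u /sub_kermxP/matrixP/(_ 0 0).
  rewrite mulmxBr !mxE => /eqP; rewrite subr_eq0 => /eqP E.
  by apply/sub_kermxP/eqP/amxP => z; rewrite rE; apply: tw_swap; rewrite /tw !mxE.
have := mxrankS le; rewrite !mxrank_ker -/(frank r).
have := rank_leq_row (amx r); have := rank_leq_col c; rewrite -/(frank r); lia.
Qed.

Lemma frank1 : frank 1%g = 0%N.
Proof.
apply/eqP; rewrite mxrank_eq0; apply/eqP/eq_mulmx => v; rewrite mulmx0.
by apply/eqP/amxP => z; rewrite act1.
Qed.

Lemma frank_prod x k : prod_of_reflections x k -> (frank x <= k)%N.
Proof.
move=> [rs [<- rsP <-]]; elim: rs rsP => [|r rs IH] rsP.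
  by rewrite big_nil frank1.
rewrite big_cons; apply: leq_trans (frankM _ _) _; rewrite -[size _]add1n.
apply: leq_add; first by apply/frank_refl/rsP; rewrite inE eqxx.
by apply: IH => t tr; apply: rsP; rewrite inE tr orbT.
Qed.

Lemma frank_l_R x : (frank x <= l_R x)%N.
Proof. exact/frank_prod/l_R_prod. Qed.

Lemma frank_full x : (frank x < n)%N -> exists v : 'rV_n, v != 0 /\ v *m amx x = 0.
Proof.
move=> lt; have : kermx (amx x) != 0.
  by rewrite -mxrank_eq0 mxrank_ker -/(frank x); lia.
by move=> /rowV0Pn[v /sub_kermxP vx v0]; exists v.
Qed.

End Rank.

(** * Meets of divisors of the Coxeter element *)

Section Atoms.
Local Open Scope ring_scope.
Variable n : nat.
Hypothesis n_gt1 : (1 < n)%N.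
Notation N := (n%:Z).

Lemma coxfun_next z : ~~ inner n z -> [/\ ~~ inner n (coxfun n z), z < coxfun n z
  & forall b, ~~ inner n b -> z < b -> coxfun n z <= b].
Proof.
move=> oz; have [_ [[lt H]|[le H]]] := coxfun_realizes n_gt1 z; last first.
  have := H (z + N) I; have := H (z - N) I.
  by rewrite /sle ?innerB ?innerD; lia.
have H1 : ~~ inner n (coxfun n z).
  rewrite /coxfun (negbTE oz); case: ifP => [iz|-> //].
  by have := inner1 n_gt1 iz; have -> : z + 1 + 1 = z + 2 by ring.
split=> //; first by move: lt; rewrite /slt; lia.
by move=> b ob zb; have := H b I; rewrite /slt; lia.
Qed.

Lemma atom_arc_lt p q (x : int -> rat) : bijective (coxfun n) ->
  ~~ inner n p -> ~~ inner n q -> p < q -> ~~ (n %| p - q)%Z ->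
  twisted n x -> (forall z, x (swap n p q (coxfun n z)) = x z) ->
  (exists z, x z != 0) -> q - p < N.
Proof.
move=> [ci cK ciK] op oq pq npq tx xf [z0 xz0]; rewrite ltNge; apply/negP => le.
case/negP: xz0; apply/eqP; have N1 : 1 < N by lia.
have tM := fun z k => twistedM n_gt1 z k tx.
have xin z : inner n z -> x z = 0.
  move=> iz; have := xf z; rewrite /coxfun iz.
  have nz a : ~~ inner n a -> ~~ (n %| z - N - a)%Z.
    move=> oa; apply: contra oa => d; have -> : a = z - N - (z - N - a) by ring.
    by rewrite /inner rpredB // -/(inner n _) innerB.
  rewrite (swap_id (nz _ op) (nz _ oq)) => E.
  by have := tx (z - N); rewrite subrK E; lra.
have const (j : nat) : forall a b, ~~ inner n a -> ~~ inner n b -> a <= b ->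
  b - a < j%:Z ->
    (forall y, a < y <= b -> ~~ (n %| y - p)%Z /\ ~~ (n %| y - q)%Z) -> x a = x b.
  elim: j => [|j IH] a b oa ob ab abj Hy; first by lia.
  have [->//|ne] := eqVneq a b.
  have [oc ac cb] := coxfun_next oa; have {}cb := cb _ ob.
  have [yp yq] : ~~ (n %| coxfun n a - p)%Z /\
    ~~ (n %| coxfun n a - q)%Z by apply: Hy; lia.
  rewrite -(xf a) (swap_id yp yq); apply: IH => //; try lia.
  by move=> y yy; apply: Hy; lia.
have [j qj] := int_window n_gt1 (q - p); pose q0 := q - j * N.
have oq0 : ~~ inner n q0 by rewrite /q0 -mulNr innerDM.
have pq0 : p != q0.
  by apply: contraNneq npq => ->; rewrite /q0 addrAC subrr add0r rpredN dvdz_mull.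
have q0p : p < q0 < p + N by rewrite /q0; lia.
have j1 : 1 <= j by nia.
have cpred a : ~~ inner n a -> ~~ inner n (ci a).
  by apply: contra => ia; rewrite -(ciK a) /coxfun ia innerB.
have [op1 oq1] := (cpred _ op, cpred _ oq0).
have [_ lp _] := coxfun_next op1; have [_ lq Hq] := coxfun_next oq1;
  rewrite !ciK in lp lq Hq.
have [_ _ Hp] := coxfun_next op1; rewrite ciK in Hp.
have pq1 : p <= ci q0 by rewrite leNgt; apply/negP => /(Hq _ op); lia.
have p1q : q0 <= ci p + N.
  rewrite leNgt; apply/negP => l; have := Hp (q0 - N);
    rewrite innerB => /(_ oq0); lia.
have ndp y k : y != p + k * N -> p + k * N - N < y < p + k * N + N ->
  ~~ (n %| y - p)%Z.
  move=> yp l; have -> : y - p = (y - (p + k * N)) + k * N by ring.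
  have := innerDM n (y - (p + k * N)) k; rewrite /inner => ->.
  by apply: ndvd_small => //; lia.
have ndq y k : y != q0 + k * N -> q0 + k * N - N < y < q0 + k * N + N ->
  ~~ (n %| y - q)%Z.
  move=> yp l; have -> : y - q = (y - (q0 + k * N)) + (k - j) * N by rewrite /q0;
    ring.
  have := innerDM n (y - (q0 + k * N)) (k - j); rewrite /inner => ->.
  by apply: ndvd_small => //; lia.
have c1 b : ~~ inner n b -> p <= b < q0 -> x p = x b.
  move=> ob pb; apply: (const (absz (b - p)%R).+1) => //; try by lia.
  by move=> y yy; split; [apply: (ndp _ 0)|apply: (ndq _ 0)]; lia.
have c2 b : ~~ inner n b -> q0 <= b < p + N -> x q0 = x b.
  move=> ob pb; apply: (const (absz (b - q0)%R).+1) => //; try by lia.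
  by move=> y yy; split; [apply: (ndp _ 0)|apply: (ndq _ 0)]; lia.
have qE : q = q0 + j * N by rewrite /q0; ring.
have two_gt (k : int) : 1 <= k -> (1 : rat) < 2 ^ k.
  case: k => [[|k]|k] // _; rewrite [_ ^ _]/(2 ^+ k.+1) exprn_egt1 // ltr1n.
have x1 : x q0 = 0.
  have := xf (ci p); rewrite ciK swap_l => E.
  have p1 : q0 <= ci p + N < p + N by lia.
  have E2 := c2 (ci p + N); rewrite innerD tx in E2.
  have H := E2 op1 p1; rewrite -E qE tM in H.
  have := two_gt j j1; move: H; move: (2 ^ j) => t; nra.
have x2 : x p = 0.
  have := xf (ci q0 + j * N).
  have -> : coxfun n (ci q0 + j * N) = q.
    rewrite qE -{2}(ciK q0); rewrite /coxfun.
    have -> : ci q0 + j * N + 1 = ci q0 + 1 + j * N by ring.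
    by rewrite !innerDM; do 2![case: ifP => _; first by ring]; ring.
  rewrite (swap_r n_gt1 npq) tM -(c1 _ oq1); last by lia.
  have := two_gt j j1; move: (2 ^ j) => t; nra.
have [iz|oz] := boolP (inner n z0); first exact: xin.
have [k kz] := int_window n_gt1 (z0 - p).
have -> : z0 = z0 - k * N + k * N by ring.
have ozk : ~~ inner n (z0 - k * N) by rewrite -mulNr innerDM.
rewrite tM; have [l|l] := ltP (z0 - k * N) q0.
  by rewrite -c1 ?x2 ?mulr0 //; lia.
by rewrite -c2 ?x1 ?mulr0 //; lia.
Qed.

End Atoms.

Section Lattice.
Local Open Scope ring_scope.
Variable n : nat.
Hypothesis n_gt1 : (1 < n)%N.
Notation N := (n%:Z).
Notation W := (coxeter_group n).
Implicit Types v w x y r : W.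

Definition ncel R w := ncrel n R /\ realizes n R (act w).

Lemma ncel_uniq R v w : ncel R v -> ncel R w -> v = w.
Proof.
move=> [_ rv] [_ rw]; apply: (act_faithful n_gt1) => z.
exact: nextp_uniq (rv z) (rw z).
Qed.

Lemma ncel_fixed R w (u : 'rV[rat]_n) : ncel R w ->
  u *m amx n_gt1 w = 0 <-> forall a b, R a b -> tw n_gt1 u a = tw n_gt1 u b.
Proof.
move=> [ncR rw]; split=> [/eqP/amxP fu|H].
  exact: (realizes_const n_gt1 ncR rw (tw_twisted n_gt1 u) fu).
by apply/eqP/amxP => z; apply/esym/H; case: (rw z).
Qed.

Lemma ncel_rel R R' w : ncel R w -> ncel R' w -> forall a b, R a b -> R' a b.
Proof.
move=> [ncR rw] [ncR' rw'] a b ab; apply: (fixed_rel n_gt1 ncR') => x tx xR'.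
apply: (realizes_const n_gt1 ncR rw tx _ ab) => z.
by apply/esym/xR'; case: (rw' z).
Qed.

Lemma reflectionK r : reflection r -> (r * r)%g = 1%g.
Proof. by move=> [i [x ->]]; rewrite -conjMg cox_gen2 conj1g. Qed.

Lemma ncel_step R R1 w : ncel R w -> ncrel n R1 -> (forall a b, R1 a b -> R a b) ->
  ~ (forall a b, R a b -> R1 a b) ->
  exists r w' R', [/\ reflection r, w = (r * w')%g, ncel R' w',
    forall a b, R1 a b -> R' a b & (frank n_gt1 w' < frank n_gt1 w)%N].
Proof.
move=> [ncR rw] ncR1 sub1 nsub.
have [s [t [st nst]]] : exists s t, R s t /\ ~ R1 s t.
  apply: contrapT => no; apply: nsub => a b ab; apply: contrapT => nab.
  by apply: no; exists a, b.
have [p [e [[Rpe lpe npe sm] sub2]]] := refine_cut n_gt1 ncR ncR1 rw sub1 st nst.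
have [r [rr rE]] := swap_reflection n_gt1 npe.
have fg := actKV n_gt1 w p.
have nc' := split_nc n_gt1 ncR rw Rpe lpe fg npe sm.
have rl' := split_realizes n_gt1 ncR rw (@act_inj _ n_gt1 w) Rpe lpe fg npe sm.
have nie := @split_ninf_e _ n_gt1 _ _ _ _ _ ncR rw Rpe lpe fg npe sm.
have [Reh nReh] := split_strict n_gt1 ncR rw Rpe lpe fg npe sm.
exists r, (r * w)%g, (cutrel n R p e); split=> //.
- by rewrite mulgA reflectionK // mul1g.
- by split=> //; apply: realizes_ext rl' => z; rewrite /= (actM n_gt1) rE.
have ncel' : ncel (cutrel n R p e) (r * w)%g.
  by split=> //; apply: realizes_ext rl' => z; rewrite /= (actM n_gt1) rE.
have ncelw : ncel R w by [].
apply: frank_lt => [u /(ncel_fixed _ ncelw) H|].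
  by apply/(ncel_fixed _ ncel') => a b [/H].
have [x [tx xR xe xb]] := block_indicator n_gt1 nc' nie.
have [u uE] := twisted_tw n_gt1 tx; exists u; split.
  by apply/(ncel_fixed _ ncel') => a b /xR; rewrite !uE.
move=> /(ncel_fixed _ ncelw) /(_ _ _ Reh); rewrite !uE xe => /esym/xb; exact: nReh.
Qed.

Lemma ncel_eq_rel R R1 w : ncel R w -> ncrel n R1 ->
  (forall a b, R1 a b <-> R a b) -> ncel R1 w.
Proof.
move=> [ncR rw] nc1 E; split=> // a; case: (rw a) => Rab H; split; first exact/E.
by case: H => -[l H]; [left|right]; split=> // c /E; apply: H.
Qed.

Lemma ncel_chain R R1 w : ncel R w -> ncrel n R1 -> (forall a b, R1 a b -> R a b) ->
  exists v u k, [/\ ncel R1 v, prod_of_reflections u k, w = (u * v)%g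
    & (k + frank n_gt1 v <= frank n_gt1 w)%N].
Proof.
have [m] := ubnP (frank n_gt1 w); elim: m w R => // m IH w R le_m ew nc1 sub1.
have [sub|nsub] := pselect (forall a b, R a b -> R1 a b).
  exists w, 1%g, 0%N; split; rewrite ?mul1g //; last exact: prod_of_reflections1.
  by apply: ncel_eq_rel ew nc1 _ => a b; split; [apply: sub1|apply: sub].
have [r [w' [R' [rr wE ew' sub' lt]]]] := ncel_step ew nc1 sub1 nsub.
have [|v [u [k [ev uk w'E le]]]] := IH w' R' _ ew' nc1 sub'; first by lia.
exists v, (r * u)%g, (1 + k)%N; split=> //; last by lia.
  exact: prod_of_reflectionsM (prod_of_reflections_refl rr) uk.
by rewrite wE w'E mulgA.
Qed.

Lemma l_R_ncel R w : ncel R w -> l_R w = frank n_gt1 w.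
Proof.
move=> ew; apply/eqP; rewrite eqn_leq frank_l_R andbT.
have [|v [u [k [ev uk wE le]]]] := ncel_chain ew (eq_nc n_gt1) _.
  by move=> a b ->; apply: (nc_refl (proj1 ew)).
have v1 : v = 1%g.
  apply: (act_faithful n_gt1) => z; rewrite (act1 n_gt1).
  by case: ev => _ /eq_realizes.
have := l_R_le uk; rewrite v1 mulg1 in wE; rewrite -wE => lk; apply: leq_trans lk _.
by move: le; rewrite v1 frank1 addn0.
Qed.

Lemma dividesP v w : divides v w <-> l_R w = (l_R v + l_R (v^-1 * w)%g)%N.
Proof.
split=> [[v' [-> ->]]|H]; first by rewrite mulKg.
by exists (v^-1 * w)%g; rewrite mulVKg.
Qed.

Lemma dividesV v w : divides v w <->
  exists2 u, w = (u * v)%g & l_R w = (l_R u + l_R v)%N.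
Proof.
split=> [[v' [E lE]]|[u E lE]].
  exists (v' ^ v^-1)%g; first by rewrite E /conjg invgK mulgA mulgVK.
  by rewrite lE l_RJ // addnC.
exists (u ^ v)%g; split; first by rewrite /conjg mulVKg.
by rewrite l_RJ // lE addnC.
Qed.

Lemma divides_trans v w x : divides v w -> divides w x -> divides v x.
Proof.
move=> [v' [-> l1]] [w' [-> l2]]; exists (v' * w')%g; split; first by rewrite mulgA.
have := l_RM v' w'; have := l_RM v (v' * w')%g; rewrite (mulgA v v' w').
move=> h1 h2; apply/eqP; rewrite eqn_leq; apply/andP; split; first exact: h1.
by rewrite [X in (_ <= X)%N]l2 l1 -addnA leq_add2l.
Qed.

Lemma ncel_divides R R1 v w : ncel R w -> ncel R1 v -> (forall a b, R1 a b ->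
  R a b) ->
  divides v w.
Proof.
move=> ew ev sub; have [nc1 _] := ev.
have [v' [u [k [ev' uk wE le]]]] := ncel_chain ew nc1 sub.
rewrite (ncel_uniq ev' ev) in wE le; apply/dividesV; exists u => //.
have := l_R_le uk; have := l_RM u v; rewrite -wE (l_R_ncel ew) (l_R_ncel ev); lia.
Qed.

Lemma ncel_cox_c : ncel onerel (cox_c n).
Proof.
split; first exact: onerel_nc.
by apply: realizes_ext (coxfun_realizes n_gt1) => z; rewrite (act_cox_c n_gt1).
Qed.

Lemma frank_cox_c : frank n_gt1 (cox_c n) = n.
Proof.
apply/eqP; rewrite eqn_leq rank_leq_row /= leqNgt; apply/negP => /frank_full[u [u0]].
move=> /(ncel_fixed _ ncel_cox_c) H; case/eqP: u0; apply/rowP => i.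
rewrite mxE -(tw_ord n_gt1); have := tw_twisted n_gt1 u i%:Z.
by rewrite (H (i%:Z + N) i%:Z I); lra.
Qed.

Lemma l_R_cox_c : l_R (cox_c n) = n.
Proof. by rewrite (l_R_ncel ncel_cox_c) frank_cox_c. Qed.

Lemma reflection_arc r p q : divides r (cox_c n) -> l_R r = 1%N ->
  act r =1 swap n p q ->
  ~~ (n %| p - q)%Z -> ~~ inner n p -> ~~ inner n q -> `|p - q| < N.
Proof.
move=> /dividesP; rewrite l_R_cox_c => lr r1 rE npq op oq.
have := frank_l_R n_gt1 (r^-1 * cox_c n)%g => le.
have lt : (frank n_gt1 (r^-1 * cox_c n)%g < n)%N by lia.
have [u [u0 /eqP/amxP fu]] := frank_full lt.
have cbij : bijective (coxfun n).
  exact: eq_bij (act_bij n_gt1 (cox_c n)) _ (act_cox_c n_gt1).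
have ux : exists z, tw n_gt1 u z != 0.
  apply: contrapT => no; case/eqP: u0; apply/rowP => i; rewrite mxE -(tw_ord n_gt1).
  by apply: contrapT => /eqP nz; apply: no; exists i%:Z.
have rV z : act r^-1%g z = swap n p q z.
  by apply: (@act_inj _ n_gt1 r); rewrite (actKV n_gt1) rE (swapK n_gt1).
have fx z : tw n_gt1 u (swap n p q (coxfun n z)) = tw n_gt1 u z.
  by rewrite -rV -(act_cox_c n_gt1) -(actM n_gt1) fu.
have npq' : ~~ (n %| q - p)%Z by rewrite -opprB rpredN.
have [l|l] : p < q \/ q < p.
    have : p != q by apply: contraNneq npq => ->; rewrite subrr dvdz0.
    by lia.
  by have := atom_arc_lt n_gt1 cbij op oq l npq (tw_twisted n_gt1 u) fx ux; lia.
have fx' z : tw n_gt1 u (swap n q p (coxfun n z)) = tw n_gt1 u z.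
  by rewrite (swapC n_gt1 npq').
by have := atom_arc_lt n_gt1 cbij oq op l npq' (tw_twisted n_gt1 u) fx' ux; lia.
Qed.

Lemma ncel_reflection R w r x : ncel R w -> divides w (cox_c n) -> reflection r ->
  w = (r * x)%g -> l_R w = (1 + l_R x)%N ->
  exists R', ncel R' x /\ forall a b, R' a b -> R a b.
Proof.
move=> ew wc rr wE lE; have [ncR rw] := ew.
have r1 : l_R r = 1%N.
  have := l_R_le (prod_of_reflections_refl rr); have := l_RM r x; rewrite -wE; lia.
have rw_ : divides r w by exists x; rewrite r1.
have [p [q [npq rE]]] := reflection_swap n_gt1 rr.
have fr : frank n_gt1 (r * x)%g = (frank n_gt1 r + frank n_gt1 x)%N.
  have := frank_l_R n_gt1 x; have := frank_refl n_gt1 rr; have := frankM n_gt1 r x.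
  rewrite -wE -(l_R_ncel ew); lia.
have Rpq : R p q.
  apply: (fixed_rel n_gt1 ncR) => y ty yR; have [u uE] := twisted_tw n_gt1 ty.
  have : u *m amx n_gt1 (r * x)%g = 0.
    by rewrite -wE; apply/(ncel_fixed _ ew) => a b /yR; rewrite !uE.
  by move=> /(frank_fix fr)/eqP/amxP/(_ p); rewrite rE swap_l !uE.
have sm : unbounded n R p -> ~~ inner n p -> ~~ inner n q -> `|p - q| < N.
  move=> _; apply: (@reflection_arc r) => //.
  exact: divides_trans rw_ wc.
have [R' [nc' rl' sub]] := swap_realizes n_gt1 ncR rw (act_bij n_gt1 w) Rpq npq sm.
exists R'; split=> //; split=> //; apply: realizes_ext rl' => z /=.
by rewrite -rE -(actM n_gt1) wE mulgA reflectionK // mul1g.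
Qed.

Lemma ncel_down R w v : ncel R w -> divides w (cox_c n) -> divides v w ->
  exists R', ncel R' v /\ forall a b, R' a b -> R a b.
Proof.
move=> ew wc /dividesV[u wE lE]; have [rs [sz rsP uE]] := l_R_prod u.
elim: rs R w u ew wc wE lE sz rsP uE => [|r rs IH] R w u ew wc wE lE sz rsP uE.
  by exists R; move: wE; rewrite -uE big_nil mul1g => <-.
have rr : reflection r by apply: rsP; rewrite inE eqxx.
rewrite big_cons in uE; set u' := (\prod_(r <- rs) r)%g in uE.
have rsP' s : s \in rs -> reflection s by move=> sr; apply: rsP; rewrite inE sr orbT.
have lu' : (l_R u' <= size rs)%N by apply: l_R_le; exists rs.
have wE' : w = (r * (u' * v))%g by rewrite wE -uE mulgA.
have lr := l_R_le (prod_of_reflections_refl rr).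
have l1 : (l_R w <= l_R r + l_R (u' * v)%g)%N by rewrite wE'; apply: l_RM.
have l2 : (l_R (u' * v)%g <= l_R u' + l_R v)%N := l_RM u' v.
have l3 : (l_R u <= l_R r + l_R u')%N by rewrite -uE; apply: l_RM.
rewrite /= in sz.
have [l4 l5] : l_R w = (1 + l_R (u' * v)%g)%N /\ l_R u' = size rs by lia.
have [R' [ex sub]] := ncel_reflection ew wc rr wE' l4.
have [||R'' [ev sub']] := IH R' (u' * v)%g u' ex _ erefl _ (esym l5) rsP' erefl.
- by apply: divides_trans wc; apply/dividesV; exists r => //; lia.
- by lia.
by exists R''; split=> // a b /sub'/sub.
Qed.

Lemma divides_meet w1 w2 : divides w1 (cox_c n) -> divides w2 (cox_c n) ->
  exists v, [/\ divides v w1, divides v w2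
    & forall u, divides u w1 -> divides u w2 -> divides u v].
Proof.
move=> d1 d2; have dc : divides (cox_c n) (cox_c n).
  by exists 1%g; rewrite mulg1 l_R1 addn0.
have [R1 [e1 _]] := ncel_down ncel_cox_c dc d1.
have [R2 [e2 _]] := ncel_down ncel_cox_c dc d2.
have [nc1 _] := e1; have [nc2 _] := e2.
have ncm := meetrel_nc n_gt1 nc1 nc2.
have [|v [_ [_ [ev _ _ _]]]] := ncel_chain e1 ncm; first by move=> a b m;
  case: (meetrel_sub m).
exists v; split.
- by apply: ncel_divides e1 ev _ => a b m; case: (meetrel_sub m).
- by apply: ncel_divides e2 ev _ => a b m; case: (meetrel_sub m).
move=> u u1 u2; have [S1 [eu1 s1]] := ncel_down e1 d1 u1.
have [S2 [eu2 s2]] := ncel_down e2 d2 u2; have [ncS1 _] := eu1.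
apply: (ncel_divides ev eu1); apply: (meetrel_max n_gt1 nc1 nc2 ncS1 s1).
by move=> a b ab; apply/s2/(ncel_rel eu1 eu2).
Qed.

Lemma cox_gen_divides i : divides (cox_gen i) (cox_c n).
Proof.
rewrite /cox_c; have sz : size (index_enum 'I_n) = n.
  by rewrite [index_enum _]unlock -enumT size_enum_ord.
have lc := l_R_cox_c; rewrite /cox_c in lc.
have refl_prod (t : seq 'I_n) : prod_of_reflections (\prod_(j <- t) cox_gen j)%g (size t).
  exists [seq cox_gen j | j <- t]; split; rewrite ?size_map ?big_map //.
  by move=> _ /mapP[j _ ->]; exists j, 1%g; rewrite conjg1.
have := mem_index_enum i => /splitPr E; case: E sz lc => a b sz.
pose A : W := (\prod_(j <- a) cox_gen j)%g;
  pose B : W := (\prod_(j <- b) cox_gen j)%g.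
have -> : (\prod_(j <- a ++ i :: b) cox_gen j)%g =
  (cox_gen i * (A ^ cox_gen i * B))%g.
  rewrite big_cat big_cons /=; apply/esym.
  by rewrite mulgA -(conjgC A) -mulgA.
move=> lc; exists (A ^ cox_gen i * B)%g; split=> //.
have lg : (l_R (cox_gen i) <= 1)%N.
  by apply/l_R_le/prod_of_reflections_refl; exists i, 1%g; rewrite conjg1.
have lAB : (l_R (A ^ cox_gen i * B)%g <= size a + size b)%N.
  apply: leq_trans (l_RM _ _) _; rewrite l_RJ //.
  by apply: leq_add; apply/l_R_le/refl_prod.
have := l_RM (cox_gen i) (A ^ cox_gen i * B)%g; move: lc lg lAB sz.
rewrite size_cat /=; move: (l_R _) (l_R _) (l_R _) => p q r; lia.
Qed.

End Lattice.

(** * The dual monoid *)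

Local Open Scope group_scope.

Section Interval.
Variable n : nat.
Hypothesis n_gt1 : (1 < n)%N.
Notation W := (coxeter_group n).
Notation P := (Pc_type n).
Notation c := (cox_c n).
Notation l := (@l_R n).
Implicit Types (v w x y a b : W) (s t u h : P).

Definition additive a b := l (a * b) = (l a + l b)%N.

Lemma l_RE a b : (l (a * b)%g <= l a + l b)%N. Proof. exact: l_RM. Qed.

Lemma additive_divides a b : additive a b -> divides a (a * b).
Proof. by exists b. Qed.

Lemma dividesE v w : divides v w -> exists2 x, w = v * x & additive v x.
Proof. by case=> x [E lE]; exists x => //; rewrite /additive -E. Qed.

Lemma divides_refl w : divides w w.
Proof. by exists 1; rewrite mulg1 l_R1 addn0. Qed.

Lemma divides1w w : divides 1 w.
Proof. by exists w; rewrite mul1g l_R1. Qed.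

Lemma divides_anti v w : divides v w -> divides w v -> v = w.
Proof.
move=> /dividesE[x E lx] [y [_ ly]]; rewrite /additive -E in lx.
have x0 : l x = 0%N by lia.
by rewrite E (l_R_eq0 x0) mulg1.
Qed.

Lemma divides_cox_c w : P_c w <-> divides w c.
Proof. by split=> [/asboolP|/asboolP]. Qed.

Lemma P_c_val s : divides (val s) c.
Proof. exact/divides_cox_c/valP. Qed.

(* Left and right divisors of c agree, as l_R is a class function. *)
Lemma P_c_right a b : divides (a * b) c -> additive a b -> divides b c.
Proof.
move=> abc lab; apply: divides_trans abc.
by apply/dividesV; exists a.
Qed.

Lemma additive_assoc a b x : additive a b -> additive (a * b) x ->
  additive b x /\ additive a (b * x).
Proof.
rewrite /additive => lab labx; have := l_RE a (b * x); have := l_RE b x.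
rewrite (mulgA a b x) labx lab; move: (l a) (l b) (l x) (l (b * x)) => p q r k; lia.
Qed.

Lemma additive_assocV a b x : additive b x -> additive a (b * x) ->
  additive a b /\ additive (a * b) x.
Proof.
rewrite /additive => lbx; have := l_RE (a * b) x; have := l_RE a b.
rewrite -(mulgA a b x) lbx; move: (l (a * (b * x))) (l (a * b)) (l a) (l b) (l x).
by move=> p q r k m; lia.
Qed.

Lemma divides_mul2l x a b : additive x a -> additive x b ->
  divides (x * a) (x * b) <-> divides a b.
Proof.
move=> la lb; split=> /dividesE[y].
  rewrite -mulgA => /mulgI E lay; rewrite E; exists y; split=> //.
  by have [] := additive_assoc la lay.
move=> E ly; rewrite E in lb *; have [_ H] := additive_assocV ly lb.
by rewrite mulgA; exists y.
Qed.

Definition pcone : P := exist _ 1 (introT (asboolP _) (divides1w c)).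
Definition pcof w : P := insubd pcone w.

Lemma pcofK w : divides w c -> val (pcof w) = w.
Proof. by move=> /divides_cox_c Pw; rewrite val_insubd Pw. Qed.

Definition pcc : P := pcof c.
Lemma val_pcc : val pcc = c. Proof. exact/pcofK/divides_refl. Qed.

Lemma quo_divides a b : divides a b -> divides b c -> divides (a^-1 * b) c.
Proof.
move=> /dividesE[x E lx] bc; rewrite E mulKg.
by rewrite E in bc; apply: P_c_right bc lx.
Qed.

Definition quo s t : P := pcof ((val s)^-1 * val t).

Lemma val_quo s t : divides (val s) (val t) ->
  val t = val s * val (quo s t) /\ additive (val s) (val (quo s t)).
Proof.
move=> st; rewrite pcofK; last exact: quo_divides (P_c_val t).
by rewrite mulVKg; split=> //; have := st => /dividesP; rewrite /additive mulVKg.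
Qed.

Definition compl s : P := quo s pcc.

Lemma val_compl s : c = val s * val (compl s) /\ additive (val s) (val (compl s)).
Proof. by rewrite -{1}val_pcc; apply: val_quo; rewrite val_pcc; apply: P_c_val. Qed.

Lemma divides_compl s a : divides a (val (compl s)) <->
  divides (val s * a) c /\ additive (val s) a.
Proof.
have [cE lc] := val_compl s; split.
  move=> /dividesE[x E lx]; rewrite E in cE lc.
  have [la H] := additive_assocV lx lc; split=> //.
  by rewrite [c]cE mulgA; exists x.
move=> [/dividesE[x E lx] la]; have := cE; rewrite {1}E -mulgA => /mulgI H.
have [lax _] := additive_assoc la lx; rewrite -H; exact: additive_divides.
Qed.

Lemma meet_ex s t : exists h, [/\ divides (val h) (val s), divides (val h) (val t)
  & forall w, divides w (val s) -> divides w (val t) -> divides w (val h)].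
Proof.
have [v [vs vt H]] := divides_meet n_gt1 (P_c_val s) (P_c_val t).
by exists (pcof v); rewrite pcofK //; apply: divides_trans vs (P_c_val s).
Qed.

Definition pmeet s t : P := projT1 (cid (meet_ex s t)).

Lemma pmeetP s t : [/\ divides (val (pmeet s t)) (val s),
   divides (val (pmeet s t)) (val t)
  & forall w, divides w (val s) -> divides w (val t) -> divides w (val (pmeet s t))].
Proof. exact: (projT2 (cid (meet_ex s t))). Qed.

Lemma pmeet_l s t : divides (val (pmeet s t)) (val s). Proof. by case: (pmeetP s t). Qed.
Lemma pmeet_r s t : divides (val (pmeet s t)) (val t). Proof. by case: (pmeetP s t). Qed.
Lemma pmeet_max s t w : divides w (val s) -> divides w (val t) ->
  divides w (val (pmeet s t)).
Proof. by case: (pmeetP s t) => _ _; apply. Qed.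

Definition absorbed s h : P := pmeet (compl s) h.
Definition head2 s h : P := pcof (val s * val (absorbed s h)).
Definition rest2 s h : P := quo (absorbed s h) h.

Lemma val_head2 s h : val (head2 s h) = val s * val (absorbed s h).
Proof. by apply: pcofK; have /divides_compl[] := pmeet_l (compl s) h. Qed.

Lemma additive_absorbed s h : additive (val s) (val (absorbed s h)).
Proof. by have /divides_compl[] := pmeet_l (compl s) h. Qed.

Lemma val_rest2 s h : val h = val (absorbed s h) * val (rest2 s h) /\
  additive (val (absorbed s h)) (val (rest2 s h)).
Proof. exact/val_quo/pmeet_r. Qed.

Lemma divides_head2 s h : divides (val s) (val (head2 s h)).
Proof. by rewrite val_head2; apply/additive_divides/additive_absorbed. Qed.

Section Associativity.
Variables s t u h : P.
Hypotheses (uE : val u = val s * val t) (ladd : additive (val s) (val t)).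

Lemma absorbed_mul : val (absorbed s (head2 t h)) = val t * val (absorbed u h).
Proof.
have /divides_compl[Pd ld] := pmeet_l (compl u) h; rewrite -/(absorbed u h) in Pd ld.
rewrite uE in Pd ld.
have [ltd lstd] := additive_assoc ladd ld.
have Ps : divides (val t * val (absorbed u h)) (val (compl s)).
  by apply/divides_compl; rewrite mulgA.
have Pt : divides (val t * val (absorbed u h)) c := divides_trans Ps (P_c_val _).
have dd2 : divides (val (absorbed u h)) (val (absorbed t h)).
  by apply: pmeet_max (pmeet_r _ _); apply/divides_compl.
apply: divides_anti; last first.
  apply: pmeet_max => //; rewrite val_head2.
  by apply/divides_mul2l => //; apply: additive_absorbed.
have t1 : divides (val t) (val (compl s)).
  by apply/divides_compl; rewrite -uE; split=> //; apply: P_c_val.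
have td : divides (val t) (val (absorbed s (head2 t h))).
  by apply: pmeet_max t1 (divides_head2 _ _).
have [e E le] := dividesE td; rewrite E.
apply/divides_mul2l => //.
have /divides_compl[Pe1 le1] := pmeet_l (compl s) (head2 t h).
rewrite -/(absorbed s _) E in Pe1 le1.
apply: pmeet_max.
  apply/divides_compl; rewrite uE; have [_ H] := additive_assocV le le1.
  by rewrite -mulgA.
apply: divides_trans (pmeet_r (compl t) h); apply/(divides_mul2l le).
  exact: additive_absorbed.
by rewrite -E -val_head2; apply: pmeet_r.
Qed.

Lemma head2_mul : head2 s (head2 t h) = head2 u h.
Proof. by apply: val_inj; rewrite !val_head2 absorbed_mul uE mulgA. Qed.

Lemma rest2_mul : val (rest2 u h) = val (rest2 s (head2 t h)) * val (rest2 t h) /\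
  additive (val (rest2 s (head2 t h))) (val (rest2 t h)).
Proof.
have [E1 l1] := val_rest2 s (head2 t h); have [E2 l2] := val_rest2 t h.
have [E3 l3] := val_rest2 u h.
have ld := additive_absorbed u h; rewrite uE in ld.
have [ltd _] := additive_assoc ladd ld.
rewrite val_head2 absorbed_mul -mulgA in E1; move/mulgI: E1 => E1.
have E : val (rest2 u h) = val (rest2 s (head2 t h)) * val (rest2 t h).
  by apply: (@mulgI _ (val (absorbed u h))); rewrite -E3 mulgA -E1.
split=> //.
have la : additive (val (absorbed u h)) (val (rest2 s (head2 t h))).
  rewrite absorbed_mul in l1; by have [] := additive_assoc ltd l1.
rewrite E1 in l2; by have [] := additive_assoc la l2.
Qed.

End Associativity.

Notation M := (dual_monoid n).
Notation und := (@underline n).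
Notation cls := (pm_class (@dual_rel n)).
Implicit Types (m : M) (p q : seq P).

Lemma cls_cons s p : cls (s :: p) = und s * cls p.
Proof. by rewrite -cat1s pm_classM. Qed.

Lemma und_mul s t u : val u = val s * val t -> additive (val s) (val t) ->
  und s * und t = und u.
Proof.
move=> E la; rewrite /underline -pm_classM; apply/pm_classP.
exact: (word_congr_rel [::] [::] (DualMul E (etrans (congr1 l E) la))).
Qed.

Lemma und1 s : val s = 1 -> und s = 1.
Proof.
move=> s1; apply/pm_classP; exact: (word_congr_rel [::] [::] (DualOne s1)).
Qed.

Lemma dual_ind (Q : M -> Prop) : Q 1 -> (forall s m, Q m -> Q (und s * m)) ->
  forall m, Q m.
Proof.
move=> Q1 QM; elim/pm_classW; elim=> [//|s p IH]; rewrite cls_cons; exact: QM.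
Qed.

Fixpoint wlen p : nat := if p is s :: p' then l (val s) + wlen p' else 0.

Lemma wlen_cat p q : wlen (p ++ q) = (wlen p + wlen q)%N.
Proof. by elim: p => //= s p ->; rewrite addnA. Qed.

Lemma wlen_congr p q : word_congr (@dual_rel n) p q -> wlen p = wlen q.
Proof.
elim=> {p q} [p q u v r|//|u v _ -> //|u v w _ -> _ -> //].
rewrite !wlen_cat; congr (_ + (_ + _))%N; case: r => [s t w _ /= ->|s /= s1].
  by rewrite !addn0.
by rewrite s1 l_R1.
Qed.

Definition dlen m : nat := wlen (repr m).

Lemma dlen_cls p : dlen (cls p) = wlen p.
Proof. by apply: wlen_congr; apply/pm_classP; rewrite /pm_class reprK. Qed.

Lemma dlenM m m' : dlen (m * m') = (dlen m + dlen m')%N.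
Proof.
elim/pm_classW: m => p; elim/pm_classW: m' => q.
by rewrite -pm_classM !dlen_cls wlen_cat.
Qed.

Lemma dlen1 : dlen 1 = 0%N. Proof. exact: dlen_cls. Qed.

Lemma dlen_und s : dlen (und s) = l (val s).
Proof. by rewrite dlen_cls /= addn0. Qed.

Lemma dlen_eq0 m : dlen m = 0%N -> m = 1.
Proof.
elim/dual_ind: m => [//|s m IH]; rewrite dlenM dlen_und => E.
have s0 : l (val s) = 0%N by lia.
rewrite (und1 (l_R_eq0 s0)) mul1g; apply: IH; lia.
Qed.

Fixpoint whead p : P := if p is s :: p' then head2 s (whead p') else pcone.
Fixpoint wtail p : seq P :=
  if p is s :: p' then rest2 s (whead p') :: wtail p' else [::].

Lemma head2_1 s h : val s = 1 -> head2 s h = h /\ val (rest2 s h) = 1.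
Proof.
move=> s1; have E : val (absorbed s h) = val h.
  apply: divides_anti (pmeet_r _ _) _; apply: pmeet_max (divides_refl _).
  have [E _] := val_compl s; rewrite s1 mul1g in E; rewrite -E; exact: P_c_val.
split; first by apply: val_inj; rewrite val_head2 s1 mul1g.
have [] := val_rest2 s h; rewrite E => H _; apply: (@mulgI _ (val h)).
by rewrite -H mulg1.
Qed.

Lemma whead_congr p q : word_congr (@dual_rel n) p q ->
  whead p = whead q /\ cls (wtail p) = cls (wtail q).
Proof.
elim=> {p q} [p q u v r|//|u v _ [-> ->] //|u v w _ [-> ->] _ [-> ->] //].
elim: p => [|s p [IH1 IH2]] /=; last by rewrite !cls_cons IH1 IH2.
case: r => [s t w wE wl|s s1] /=.
  rewrite wE in wl; have H := head2_mul (whead q) wE wl; rewrite H; split=> //.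
  rewrite !cls_cons mulgA; congr (_ * _).
  by have [E le] := rest2_mul (whead q) wE wl; apply: und_mul.
have [-> r1] := head2_1 (whead q) s1; split=> //.
by rewrite cls_cons (und1 r1) mul1g.
Qed.

Definition dhead m : P := whead (repr m).
Definition dtail m : M := cls (wtail (repr m)).

Lemma dhead_cls p : dhead (cls p) = whead p.
Proof. by have [] := @whead_congr (repr (cls p)) p; first by apply/pm_classP;
  rewrite /pm_class reprK. Qed.

Lemma dtail_cls p : dtail (cls p) = cls (wtail p).
Proof. by have [] := @whead_congr (repr (cls p)) p; first by apply/pm_classP;
  rewrite /pm_class reprK. Qed.

Lemma dhead_und s m : dhead (und s * m) = head2 s (dhead m).
Proof. by elim/pm_classW: m => p; rewrite -cls_cons !dhead_cls. Qed.

Lemma dtail_und s m : dtail (und s * m) = und (rest2 s (dhead m)) * dtail m.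
Proof. by elim/pm_classW: m => p;
  rewrite -cls_cons !dtail_cls dhead_cls /= cls_cons. Qed.

Lemma dhead1 : dhead 1 = pcone. Proof. exact: dhead_cls. Qed.

Lemma dhead_tail m : m = und (dhead m) * dtail m.
Proof.
elim/dual_ind: m => [|s m IH].
  by rewrite dhead1 (dtail_cls [::]) und1 // mul1g.
rewrite dhead_und dtail_und {1}IH.
have [E le] := val_rest2 s (dhead m).
rewrite -(und_mul E le) !mulgA; congr (_ * _ * _); apply: und_mul.
  exact: val_head2.
exact: additive_absorbed.
Qed.

Lemma und_mulI s m m' : und s * m = und s * m' -> m = m'.
Proof.
move=> E; have := dhead_und s m; have := dtail_und s m.
rewrite E dhead_und dtail_und => Et Eh.
have Ea : absorbed s (dhead m) = absorbed s (dhead m').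
  by apply: val_inj; apply: (@mulgI _ (val s)); rewrite -!val_head2 Eh.
rewrite (dhead_tail m) (dhead_tail m').
have [E1 l1] := val_rest2 s (dhead m); have [E2 l2] := val_rest2 s (dhead m').
by rewrite -(und_mul E1 l1) -(und_mul E2 l2) -!mulgA Ea Et.
Qed.

Lemma dmulI m m1 m2 : m * m1 = m * m2 -> m1 = m2.
Proof.
elim/dual_ind: m => [|s m IH]; first by rewrite !mul1g.
by rewrite -!mulgA => /und_mulI.
Qed.

Lemma left_divides_und s m : left_divides (und s) m <-> divides (val s) (val (dhead m)).
Proof.
split=> [[m' ->]|]; first by rewrite dhead_und; apply: divides_head2.
move=> /val_quo[E le]; exists (und (quo s (dhead m)) * dtail m).
by rewrite mulgA (und_mul E le) -dhead_tail.
Qed.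

Lemma dhead_underline s : dhead (und s) = s.
Proof.
have := dhead_und s 1; rewrite mulg1 dhead1 => ->; apply: val_inj; rewrite val_head2.
have : divides (val (absorbed s pcone)) 1 := pmeet_r _ _.
by move=> /divides_anti/(_ (divides1w _)) ->; rewrite mulg1.
Qed.

Lemma left_divides_trans m1 m2 m3 : left_divides m1 m2 -> left_divides m2 m3 ->
  left_divides m1 m3.
Proof. by move=> [a ->] [b ->]; exists (a * b); rewrite mulgA. Qed.

Lemma left_divides_anti m m' : left_divides m m' -> left_divides m' m -> m = m'.
Proof.
move=> [a ->] [b E]; have := congr1 dlen E; rewrite !dlenM => le.
have a0 : dlen a = 0%N by lia.
by rewrite (dlen_eq0 a0) mulg1.
Qed.

Lemma dhead_greatest m : greatest_left_divisor_in (@in_underline_Pc n) m (und (dhead m)).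
Proof.
split; [by exists (dhead m)|by exists (dtail m); apply: dhead_tail|].
move=> _ [s ->] /left_divides_und H; apply/left_divides_und.
by rewrite dhead_underline.
Qed.

Lemma greatest_dhead m (a : M) :
  greatest_left_divisor_in (@in_underline_Pc n) m a -> a = und (dhead m).
Proof.
move=> [[s ->] sm H]; have [Sd dm Hd] := dhead_greatest m.
by apply: left_divides_anti; [apply: Hd => //; exists s|apply: H].
Qed.

Lemma dhead_eq1 m : val (dhead m) = 1 -> m = 1.
Proof.
elim/dual_ind: m => [//|s m IH]; rewrite dhead_und val_head2 => E.
have := additive_absorbed s (dhead m); rewrite /additive E l_R1 => le.
have s0 : l (val s) = 0%N by lia.
move: E; rewrite (und1 (l_R_eq0 s0)) mul1g (l_R_eq0 s0) mul1g => E.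
apply: IH; rewrite -[RHS]E; congr val; apply/val_inj.
have [H _] := head2_1 (dhead m) (l_R_eq0 s0).
by rewrite -{1}H val_head2 (l_R_eq0 s0) mul1g.
Qed.

Lemma normal_form_ex m : exists r : seq M, normal_form m r.
Proof.
have [k] := ubnP (dlen m); elim: k m => // k IH m le.
have [m1|m1] := pselect (m = 1); first by exists [::]; split; rewrite ?big_nil.
have lh : (0 < dlen (und (dhead m)))%N.
  rewrite dlen_und lt0n; apply/eqP => h0; apply: m1; apply: dhead_eq1.
  exact: l_R_eq0.
have E := dhead_tail m.
have [|s [tE sg sl]] := IH (dtail m).
  by have := congr1 dlen E; rewrite dlenM; lia.
exists (und (dhead m) :: s); split.
- by rewrite big_cons -tE.
- case=> [_|i /sg //]; rewrite drop0 big_cons -tE /= -E; exact: dhead_greatest.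
- move=> _ /=; case: s tE sg sl => [_ _ _ /=|a s _ _ sl]; last exact: sl.
  by move=> h1; move: lh; rewrite h1 dlen1.
Qed.

Lemma normal_form_uniq m (s s' : seq M) : normal_form m s -> normal_form m s' ->
  s = s'.
Proof.
have one (s0 : seq M) : normal_form 1 s0 -> s0 = [::].
  case: s0 => // a s0 [E _ /(_ isT) lst]; case: lst.
  have all1 (r : seq M) : \prod_(z <- r) z = 1 -> forall z, z \in r -> z = 1.
    elim: r => // b r IH; rewrite big_cons => Er x; have := congr1 dlen Er.
    rewrite dlenM dlen1 => /eqP; rewrite addn_eq0 => /andP[/eqP b0 /eqP r0].
    rewrite inE => /predU1P[->|]; first exact: dlen_eq0.
    by apply: IH; apply: dlen_eq0.
  by apply: (all1 _ (esym E)); rewrite /= mem_last.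
elim: s m s' => [|a s IH] m s'.
  by move=> [-> _ _]; rewrite big_nil => /one.
case: s' => [|a' s'].
  by move=> H [E _ _]; move: H; rewrite E big_nil => /one.
move=> [E g lst] [E' g' lst'].
have ga := g 0%N isT; have ga' := g' 0%N isT.
rewrite /= -E in ga; rewrite /= -E' in ga'.
have aa : a = a' by rewrite (greatest_dhead ga) (greatest_dhead ga').
subst a'; congr cons; apply: (IH (\prod_(z <- s) z)).
  split=> //; first by move=> i; apply: (g i.+1).
  by case: s lst {IH E g ga} => // b s lst _; apply: lst.
have -> : \prod_(z <- s) z = \prod_(z <- s') z.
  by have := E'; rewrite {1}E !big_cons => /dmulI.
split=> //; first by move=> i; apply: (g' i.+1).
by case: s' lst' {E' g' ga'} => // b s' lst' _; apply: lst'.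
Qed.


Definition head_meet m m' : P := pmeet (dhead m) (dhead m').

Lemma head_meet_und s m m' : head_meet (und s * m) (und s * m') =
  head2 s (head_meet m m').
Proof.
apply: val_inj; rewrite /head_meet !dhead_und.
have cong h h' : divides (val h) (val h') ->
  divides (val (head2 s h)) (val (head2 s h')).
  move=> hh; rewrite !val_head2.
  apply/divides_mul2l; try exact: additive_absorbed.
  apply: pmeet_max (pmeet_l _ _) _; exact: divides_trans (pmeet_r _ _) hh.
apply: divides_anti; last first.
  by apply: pmeet_max; apply: cong; [apply: pmeet_l|apply: pmeet_r].
have sd : divides (val s) (val (pmeet (head2 s (dhead m)) (head2 s (dhead m')))).
  by apply: pmeet_max; apply: divides_head2.
have [e E le] := dividesE sd.
have He h : divides (val (pmeet (head2 s (dhead m)) (head2 s (dhead m')))) (val (head2 s h)) ->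
    divides e (val (absorbed s h)).
  rewrite E val_head2 => /divides_mul2l; apply=> //; exact: additive_absorbed.
have e1 := He _ (pmeet_l _ _); have e2 := He _ (pmeet_r _ _).
rewrite E val_head2; apply/divides_mul2l => //; first exact: additive_absorbed.
apply: pmeet_max; first exact: divides_trans e1 (pmeet_l _ _).
by apply: pmeet_max; [apply: divides_trans e1 (pmeet_r _ _)|apply: divides_trans e2 (pmeet_r _ _)].
Qed.

Lemma head_meet_coprime (x : M) m m' : left_coprime m m' ->
  head_meet (x * m) (x * m') = dhead x.
Proof.
move=> co; have h1 : head_meet m m' = pcone.
  have d1 : left_divides (und (head_meet m m')) m by apply/left_divides_und/pmeet_l.
  have d2 : left_divides (und (head_meet m m')) m' by apply/left_divides_und/pmeet_r.
  have := congr1 dlen (co _ d1 d2); rewrite dlen_und dlen1 => /l_R_eq0 E.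
  exact: val_inj.
elim/dual_ind: x => [|s x IH]; first by rewrite !mul1g dhead1.
by rewrite -!mulgA head_meet_und IH -dhead_und.
Qed.

Lemma coprime_divides m m' : left_coprime m m' -> forall d x : M,
  left_divides d (x * m) -> left_divides d (x * m') -> left_divides d x.
Proof.
move=> co d; have [k] := ubnP (dlen d); elim: k d => // k IH d le x dm dm'.
have [->|d1] := pselect (d = 1); first by exists x; rewrite mul1g.
have dE := dhead_tail d; set s := dhead d in dE.
have sd : left_divides (und s) d by exists (dtail d).
have s0 : (0 < dlen (und s))%N.
  rewrite dlen_und lt0n; apply/eqP => /l_R_eq0 h; exact/d1/dhead_eq1.
have [x' xE] : left_divides (und s) x.
  apply/left_divides_und; rewrite -(head_meet_coprime x co); apply: pmeet_max.
    by apply/left_divides_und; apply: left_divides_trans sd dm.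
  by apply/left_divides_und; apply: left_divides_trans sd dm'.
have cut (y : M) : left_divides d (x * y) -> left_divides (dtail d) (x' * y).
  by move=> [z]; rewrite {1}dE xE -!mulgA => /dmulI E; exists z.
have [|z zE] := IH (dtail d) _ x' (cut _ dm) (cut _ dm').
  by have := congr1 dlen dE; rewrite dlenM; lia.
by exists z; rewrite xE zE mulgA -dE.
Qed.

Definition delta : M := und pcc.

Lemma conjg_cox_c : c ^ c^-1 = c.
Proof. by rewrite /conjg invgK mulgV mulg1. Qed.

Definition conjc s : P := pcof (val s ^ c^-1).

Lemma val_conjc s : val (conjc s) = val s ^ c^-1.
Proof.
apply: pcofK; have [x E lx] := dividesE (P_c_val s).
exists (x ^ c^-1); rewrite -conjMg -E conjg_cox_c !l_RJ; split=> //.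
exact: etrans (congr1 l E) lx.
Qed.

Definition dconj m : M := cls (map conjc (repr m)).

Lemma conjc_congr p q : word_congr (@dual_rel n) p q ->
  word_congr (@dual_rel n) (map conjc p) (map conjc q).
Proof.
elim=> {p q} [p q u v r|u|u v _ IH|u v w _ IH1 _ IH2].
- rewrite !map_cat; apply: word_congr_rel.
  case: r => [s t w E le|s s1] /=.
    by apply: DualMul; rewrite !val_conjc ?l_RJ // -conjMg E.
  by apply: DualOne; rewrite val_conjc s1 conj1g.
- exact: word_congr_refl.
- exact: word_congr_sym.
- exact: word_congr_trans IH1 IH2.
Qed.

Lemma dconj_cls p : dconj (cls p) = cls (map conjc p).
Proof. by apply/pm_classP/conjc_congr/pm_classP; rewrite /pm_class reprK. Qed.

Lemma dconjM m m' : dconj (m * m') = dconj m * dconj m'.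
Proof.
elim/pm_classW: m => p; elim/pm_classW: m' => q.
by rewrite -pm_classM !dconj_cls map_cat pm_classM.
Qed.

Lemma dconj1 : dconj 1 = 1. Proof. exact: dconj_cls. Qed.

Lemma dconj_und s : dconj (und s) = und (conjc s).
Proof. exact: dconj_cls. Qed.

Lemma rcompl_delta s :
  exists t, und t * und s = delta /\ und (conjc s) * und t = delta.
Proof.
have [x E lx] : exists2 x, c = x * val s & l c = (l x + l (val s))%N.
  by apply/dividesV/P_c_val.
have xc : divides x c by exists (val s).
have xK := pcofK xc.
have E2 : val s ^ c^-1 * x = c.
  have cx : c^-1 * x = (val s)^-1 by rewrite E invgM mulgVK.
  by rewrite /conjg invgK -!mulgA cx mulgV mulg1.
exists (pcof x); split; apply: und_mul; rewrite /additive ?val_pcc ?val_conjc xK.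
- exact: E.
- by rewrite -E.
- by rewrite E2.
- by rewrite E2 l_RJ addnC.
Qed.

Lemma delta_comm m : delta * m = dconj m * delta.
Proof.
elim/dual_ind: m => [|s m IH]; first by rewrite dconj1 mul1g mulg1.
have [t [ts st]] := rcompl_delta s.
rewrite dconjM dconj_und -[RHS]mulgA -IH -{1}st.
by rewrite -!mulgA (mulgA (und t)) ts.
Qed.

Lemma delta_pow_comm k m : delta ^+ k * m = iter k dconj m * delta ^+ k.
Proof.
elim: k m => [|k IH] m; first by rewrite mul1g mulg1.
by rewrite expgSr -mulgA delta_comm mulgA IH -mulgA iterSr -expgSr.
Qed.

Lemma iter_dconjM k m m' : iter k dconj (m * m') = iter k dconj m * iter k dconj m'.
Proof. by elim: k => //= k ->; rewrite dconjM. Qed.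

Lemma dconj_delta k j : iter k dconj (delta ^+ j) = delta ^+ j.
Proof.
have d1 : dconj delta = delta.
  rewrite dconj_und; congr underline; apply: val_inj.
  by rewrite val_conjc val_pcc conjg_cox_c.
have dj : dconj (delta ^+ j) = delta ^+ j.
  by elim: j => [|j IH]; [exact: dconj1|rewrite expgS dconjM d1 IH].
by elim: k => //= k ->.
Qed.

Lemma delta_linv m : exists k (x : M), x * m = delta ^+ k.
Proof.
elim/dual_ind: m => [|s m [k [x E]]]; first by exists 0%N, 1; rewrite mul1g.
have [t [ts _]] := rcompl_delta s.
exists k.+1, (dconj x * und t).
by rewrite -mulgA (mulgA (und t)) ts mulgA -delta_comm -mulgA E expgS.
Qed.

Definition fraction := (nat * M)%type.

Definition frac_eq (x y : fraction) : bool :=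
  `[< delta ^+ y.1 * x.2 = delta ^+ x.1 * y.2 >].

Lemma frac_eqP (x y : fraction) :
  reflect (delta ^+ y.1 * x.2 = delta ^+ x.1 * y.2) (frac_eq x y).
Proof. exact: asboolP. Qed.

Lemma frac_eq_refl : reflexive frac_eq.
Proof. by move=> x; apply/frac_eqP. Qed.

Lemma frac_eq_sym : symmetric frac_eq.
Proof. by move=> x y; apply/frac_eqP/frac_eqP. Qed.

Lemma delta_powC j k m : delta ^+ j * (delta ^+ k * m) =
  delta ^+ k * (delta ^+ j * m).
Proof. by rewrite !mulgA -!expgnDr addnC. Qed.

Lemma frac_eq_trans : transitive frac_eq.
Proof.
move=> y x z /frac_eqP xy /frac_eqP yz; apply/frac_eqP;
  apply: (@dmulI (delta ^+ y.1)).
by rewrite delta_powC xy delta_powC yz delta_powC.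
Qed.

Canonical frac_equiv := EquivRel frac_eq frac_eq_refl frac_eq_sym frac_eq_trans.
Definition frac_group := {eq_quot frac_equiv}%qT.
HB.instance Definition _ := EqQuotient.on frac_group.
HB.instance Definition _ := Choice.on frac_group.

Definition fclass (x : fraction) : frac_group := (\pi_frac_group x)%qT.

Lemma fclassP (x y : fraction) : fclass x = fclass y <-> delta ^+ y.1 * x.2 =
  delta ^+ x.1 * y.2.
Proof.
rewrite /fclass; split=> [/eqP|xy]; first by rewrite piE => /frac_eqP.
by apply/eqP; rewrite piE; apply/frac_eqP.
Qed.

Lemma fclassW (Q : frac_group -> Prop) : (forall k m, Q (fclass (k, m))) ->
  forall x : frac_group, Q x.
Proof. by move=> H x; rewrite -[x]reprK; case: (repr x) => k m; apply: H. Qed.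

(* (k, m) stands for delta^-k m, and m delta^-k = delta^-k (iter k dconj m). *)
Definition mulf (x y : fraction) : fraction := ((x.1 + y.1)%N,
  iter y.1 dconj x.2 * y.2).

Definition fmul (x y : frac_group) : frac_group := fclass (mulf (repr x) (repr y)).

Lemma fmul_class (x y : fraction) : fmul (fclass x) (fclass y) = fclass (mulf x y).
Proof.
have rP (z : fraction) : delta ^+ z.1 * (repr (fclass z)).2 =
  delta ^+ (repr (fclass z)).1 * z.2.
  by apply/fclassP; rewrite /fclass reprK.
have := rP x; have := rP y; rewrite /fmul.
move: (repr (fclass x)) (repr (fclass y)) => x' y' yy xx; apply/fclassP.
case: x y x' y' xx yy => [k m] [k' m'] [j r] [j' r'] /= xx yy.
rewrite expgnDr -mulgA (mulgA (delta ^+ k')) (delta_pow_comm k') -iterD -mulgA yy.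
rewrite mulgA -(dconj_delta (k' + j') k) -iter_dconjM xx iter_dconjM dconj_delta.
by rewrite addnC iterD -mulgA (mulgA _ _ m') -(delta_pow_comm j') expgnDr !mulgA.
Qed.

Lemma fmulA : associative fmul.
Proof.
elim/fclassW=> k m; elim/fclassW=> k' m'; elim/fclassW=> k'' m''.
rewrite !fmul_class /mulf /=; congr fclass; congr pair; first by rewrite addnA.
by rewrite iter_dconjM -iterD mulgA addnC.
Qed.

Lemma fmul1 : left_id (fclass (0%N, 1)) fmul.
Proof.
elim/fclassW=> k m; rewrite fmul_class /mulf /= add0n.
by have := dconj_delta k 0; rewrite expg0 => ->; rewrite mul1g.
Qed.

Lemma fmulx1 : right_id (fclass (0%N, 1)) fmul.
Proof. by elim/fclassW=> k m; rewrite fmul_class /mulf /= addn0 mulg1. Qed.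

HB.instance Definition _ := isMonoid.Build frac_group fmulA fmul1 fmulx1.

Lemma fmul_linv (x : frac_group) : exists y : frac_group, y * x = 1.
Proof.
elim/fclassW: x => k m; have [j [x E]] := delta_linv m.
exists (fclass (j, x * delta ^+ k)); apply: etrans (fmul_class _ _) _;
  apply/fclassP => /=.
by rewrite !mul1g iter_dconjM dconj_delta -delta_pow_comm -mulgA E mulg1 -expgnDr addnC.
Qed.

Definition finv (x : frac_group) : frac_group := projT1 (cid (fmul_linv x)).

Lemma fmulV : left_inverse (1 : frac_group) finv *%g.
Proof. by move=> x; exact: (projT2 (cid (fmul_linv x))). Qed.

Lemma fVmul : right_inverse (1 : frac_group) finv *%g.
Proof.
move=> x; rewrite -[LHS]mul1g -{1}(fmulV (finv x)) -mulgA (mulgA (finv x)).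
by rewrite fmulV mul1g fmulV.
Qed.

HB.instance Definition _ := hasInv.Build frac_group finv.
HB.instance Definition _ := Monoid_isGroup.Build frac_group fmulV fVmul.

Definition to_frac m : frac_group := fclass (0%N, m).

Lemma to_frac_morphism : monoid.monoid_morphism to_frac.
Proof. by split=> // m m'; apply/esym; apply: etrans (fmul_class _ _) _. Qed.

Lemma to_frac_inj : injective to_frac.
Proof. by move=> m m' /fclassP /=; rewrite !mul1g. Qed.

Notation B := (artin_group n).

Section Fractions.
Variable iota : M -> B.
Hypothesis iotaP : fractions_identification iota.

Lemma iotaM m m' : iota (m * m') = iota m * iota m'.
Proof. by case: iotaP => -[[_ H] _] _. Qed.

Lemma iota1 : iota 1 = 1.
Proof. by case: iotaP => -[[H _] _] _. Qed.

Lemma iota_inj : injective iota.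
Proof.
case: iotaP => -[_ univ] _; have [g [[_ gE] _]] :=
  univ frac_group to_frac to_frac_morphism.
by move=> m m' E; apply: to_frac_inj; rewrite -!gE E.
Qed.

Lemma artin_ind (Q : B -> Prop) : Q 1 -> (forall i (g : B), Q g ->
  Q (art_gen i * g)) ->
  (forall i (g : B), Q g -> Q ((art_gen i)^-1 * g)) -> forall g : B, Q g.
Proof.
move=> Q1 QM QV; elim/pm_classW; elim=> [//|[b i] u IH].
rewrite -cat1s pm_classM; case: b; last exact: QM.
suff -> : pm_class (group_rel (@artin_rel n)) [:: (true,
  i)] = (art_gen i)^-1 by apply: QV.
apply: (@mulgI _ (art_gen i)); rewrite mulgV /art_gen /pg_gen -pm_classM.
apply/pm_classP; exact: (word_congr_rel [::] [::] (group_rel_cancel _ false i)).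
Qed.

Lemma fraction_ex (g : B) : exists k m, g = (iota (delta ^+ k))^-1 * iota m.
Proof.
have [_ gen] := iotaP.
pose S (i : 'I_n) : P := pcof (cox_gen i).
have SE i : art_gen i = iota (und (S i)).
  by apply/esym/gen/pcofK/cox_gen_divides.
have left (x : M) (g' : B) : (exists k m, g' = (iota (delta ^+ k))^-1 * iota m) ->
    exists k m, iota x * g' = (iota (delta ^+ k))^-1 * iota m.
  move=> [k [m ->]]; exists k, (iter k dconj x * m).
  apply: (@mulgI _ (iota (delta ^+ k))); rewrite mulVKg mulgA -iotaM delta_pow_comm.
  by rewrite !iotaM -!mulgA mulVKg.
elim/artin_ind: g => [|i g IH|i g IH].
- by exists 0%N, 1; rewrite iota1 mulg1 invg1.
- by rewrite SE; apply: left.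
- have [t [ts _]] := rcompl_delta (S i).
  have [k [m E]] := left (und t) g IH.
  have sV : (iota (und (S i)))^-1 = (iota delta)^-1 * iota (und t).
    by rewrite -ts iotaM invgM mulgVK.
  by exists k.+1, m; rewrite SE sV -mulgA E mulgA -invgM -iotaM -expgSr.
Qed.

Lemma coprime_reduction m m' : exists (d a b : M),
  [/\ m = d * a, m' = d * b & left_coprime a b].
Proof.
have [k] := ubnP (dlen m); elim: k m m' => // k IH m m' le.
have [co|nco] := pselect (left_coprime m m').
  by exists 1, m, m'; rewrite !mul1g.
have [d [[a aE] [b bE] d1]] : exists d : M,
    [/\ left_divides d m, left_divides d m' & d <> 1].
  apply: contrapT => no; apply: nco => d dm dm'; apply: contrapT => d1.
  by apply: no; exists d.
have [|d' [a' [b' [aE' bE' co]]]] := IH a b.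
  have d0 : dlen d <> 0%N by move=> /dlen_eq0.
  by move: le; rewrite aE dlenM; lia.
by exists (d * d'), a', b'; rewrite aE bE aE' bE' !mulgA.
Qed.

Lemma coprime_fraction_ex (g : B) : exists a b : M,
  left_coprime a b /\ g = (iota a)^-1 * iota b.
Proof.
have [k [m ->]] := fraction_ex g.
have [d [a [b [-> -> co]]]] := coprime_reduction (delta ^+ k) m.
by exists a, b; split=> //; rewrite !iotaM invgM mulgA mulgVK.
Qed.

Lemma coprime_fraction_uniq (a b a' b' : M) : left_coprime a b ->
  left_coprime a' b' ->
  (iota a)^-1 * iota b = (iota a')^-1 * iota b' -> a = a' /\ b = b'.
Proof.
move=> co co' E.
have [k [x xE]] := delta_linv a; have [k' [x' xE']] := delta_linv a'.
pose y := delta ^+ k' * x; pose y' := delta ^+ k * x'.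
have ya : y * a = y' * a' by rewrite -!mulgA xE xE' -!expgnDr addnC.
have yb : y * b = y' * b'.
  apply: iota_inj; rewrite (iotaM y b) (iotaM y' b').
  have -> : iota b = iota a * ((iota a')^-1 * iota b') by rewrite -E mulVKg.
  by rewrite (mulgA (iota y)) -(iotaM y a) ya (iotaM y' a') -!mulgA mulVKg.
have yy : y = y'.
  apply: left_divides_anti.
    by apply: (coprime_divides co'); [exists a|exists b].
  by apply: (coprime_divides co); [exists a'|exists b'].
by rewrite -yy in ya yb; split; [exact: dmulI ya|exact: dmulI yb].
Qed.

End Fractions.

End Interval.

Theorem proposition5p6 (n : nat) (hn : 2 <= n) :
  (forall iota : dual_monoid n -> artin_group n,
     fractions_identification iota ->
     forall g : artin_group n,
       exists! ab : dual_monoid n * dual_monoid n,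
         left_coprime ab.1 ab.2 /\ g = (iota ab.1)^-1 * iota ab.2) /\
  (forall m : dual_monoid n,
     exists! s : seq (dual_monoid n), normal_form m s).
Proof.
split=> [iota iotaP g|m].
  have [a [b [co gE]]] := coprime_fraction_ex hn iotaP g.
  exists (a, b); split=> // -[a' b'] /= [co' gE'].
  have [-> ->] := coprime_fraction_uniq hn iotaP co co' (etrans (esym gE) gE') => //.
have [s sm] := normal_form_ex hn m.
by exists s; split=> // s'; apply: normal_form_uniq.
Qed.
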